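(* Let $X$ be a Banach space, $A(t)\in\mathcal B(X)$ continuous in $t\in\mathbb R$, and suppose $x'=A(t)x$ admits a nonuniform $(h,k,\mu,\nu)$-dichotomy on $\mathbb R$ with constants $a<0\le b$, $\varepsilon\ge0$, $K>0$, where $h,k$ are differentiable. Let $f:\mathbb R\times X\to X$ be continuous and suppose there are constants $\alpha,\gamma>0$ such that for all $t\in\mathbb R$, $x,x_1,x_2\in X$: $\|f(t,x)\|\le\alpha\min\{h'(t)h(t)^{-1}\mu(|t|)^{-\varepsilon},k'(t)k(t)^{-1}\nu(|t|)^{-\varepsilon}\}$ and $\|f(t,x_1)-f(t,x_2)\|\le\gamma\min\{h'(t)h(t)^{-1}\mu(|t|)^{-\varepsilon},k'(t)k(t)^{-1}\nu(|t|)^{-\varepsilon}\}\|x_1-x_2\|$, and $K\gamma(1/|a|+1/b)<1$. Then $x'=A(t)x+f(t,x)$ is topologically equivalent to $x'=A(t)x$, and the equivalence function $H$ satisfies $\|H(t,x)-x\|\le K\alpha(1/|a|+1/b)$ for all $t\in\mathbb R$, $x\in X$.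
   Context: A growth rate is an increasing function $u:\mathbb R\to(0,\infty)$ with $u(0)=1$, $\lim_{t\to+\infty}u(t)=\infty$ and $\lim_{t\to-\infty}u(t)=0$; $h,k,\mu,\nu$ are growth rates. Nonuniform $(h,k,\mu,\nu)$-dichotomy on $\mathbb R$ for $x'=A(t)x$ with evolution operator $T(t,s)$ ($T(t,s)x(s)=x(t)$ for every solution): there are projections $P(t)$, $t\in\mathbb R$, with $P(t)T(t,s)=T(t,s)P(s)$ for all $t,s$, and constants $a<0\le b$, $\varepsilon\ge0$, $K>0$ such that $\|T(t,s)P(s)\|\le K(h(t)/h(s))^a\mu(|s|)^\varepsilon$ for $t\ge s$ and $\|T(t,s)Q(s)\|\le K(k(s)/k(t))^{-b}\nu(|s|)^\varepsilon$ for $s\ge t$, where $Q(t)=\mathrm{Id}-P(t)$. Topological equivalence: $x'=A(t)x$ and $x'=A(t)x+f(t,x)$ are topologically equivalent if there is $H:\mathbb R\times X\to X$ such that (i) $\|H(t,x)\|\to\infty$ as $\|x\|\to\infty$ uniformly in $t$; (ii) for each $t$, $H(t,\cdot)$ is a homeomorphism of $X$; (iii) $L(t,\cdot)=H(t,\cdot)^{-1}$ also satisfies (i); (iv) if $x(t)$ solves $x'=A(t)x+f(t,x)$ then $H(t,x(t))$ solves $x'=A(t)x$. *)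

(* Defs.v *)
From Stdlib Require Import Reals Lra.
Open Scope R_scope.
Set Implicit Arguments.

Record NormedSpace : Type := {
  ns_car :> Type;
  ns_zero : ns_car;
  ns_add : ns_car -> ns_car -> ns_car;
  ns_opp : ns_car -> ns_car;
  ns_scal : R -> ns_car -> ns_car;
  ns_norm : ns_car -> R;
  ns_addA : forall x y z, ns_add x (ns_add y z) = ns_add (ns_add x y) z;
  ns_addC : forall x y, ns_add x y = ns_add y x;
  ns_add0 : forall x, ns_add ns_zero x = x;
  ns_addN : forall x, ns_add x (ns_opp x) = ns_zero;
  ns_scalA : forall a b x, ns_scal a (ns_scal b x) = ns_scal (a * b) x;
  ns_scal1 : forall x, ns_scal 1 x = x;
  ns_scalDr : forall a x y, ns_scal a (ns_add x y) = ns_add (ns_scal a x) (ns_scal a y);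
  ns_scalDl : forall a b x, ns_scal (a + b) x = ns_add (ns_scal a x) (ns_scal b x);
  ns_norm_eq0 : forall x, ns_norm x = 0 -> x = ns_zero;
  ns_normZ : forall a x, ns_norm (ns_scal a x) = Rabs a * ns_norm x;
  ns_normD : forall x y, ns_norm (ns_add x y) <= ns_norm x + ns_norm y
}.

Arguments ns_zero {n}.
Arguments ns_add {n}.
Arguments ns_opp {n}.
Arguments ns_scal {n}.
Arguments ns_norm {n}.

Definition ns_sub {X : NormedSpace} (x y : X) : X := ns_add x (ns_opp y).

Definition complete (X : NormedSpace) : Prop :=
  forall u : nat -> X,
    (forall e, 0 < e -> exists N, forall m n, (N <= m)%nat -> (N <= n)%nat ->
        ns_norm (ns_sub (u m) (u n)) < e) ->
    exists l : X, forall e, 0 < e -> exists N, forall n, (N <= n)%nat ->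
        ns_norm (ns_sub (u n) l) < e.

Definition bounded_linear {X : NormedSpace} (L : X -> X) : Prop :=
  (forall x y, L (ns_add x y) = ns_add (L x) (L y)) /\
  (forall c x, L (ns_scal c x) = ns_scal c (L x)) /\
  (exists C, forall x, ns_norm (L x) <= C * ns_norm x).

Definition op_continuous {X : NormedSpace} (A : R -> X -> X) : Prop :=
  forall t e, 0 < e -> exists d, 0 < d /\ forall s, Rabs (s - t) < d ->
    forall x, ns_norm (ns_sub (A s x) (A t x)) <= e * ns_norm x.

Definition continuous_map {X : NormedSpace} (g : X -> X) : Prop :=
  forall x e, 0 < e -> exists d, 0 < d /\ forall y, ns_norm (ns_sub y x) < d ->
    ns_norm (ns_sub (g y) (g x)) < e.

Definition jointly_continuous {X : NormedSpace} (f : R -> X -> X) : Prop :=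
  forall t x e, 0 < e -> exists d, 0 < d /\ forall s y,
    Rabs (s - t) < d -> ns_norm (ns_sub y x) < d ->
    ns_norm (ns_sub (f s y) (f t x)) < e.

Definition has_deriv {X : NormedSpace} (x : R -> X) (t : R) (v : X) : Prop :=
  forall e, 0 < e -> exists d, 0 < d /\ forall r, r <> 0 -> Rabs r < d ->
    ns_norm (ns_sub (ns_sub (x (t + r)) (x t)) (ns_scal r v)) <= e * Rabs r.

Definition is_solution {X : NormedSpace} (F : R -> X -> X) (x : R -> X) : Prop :=
  forall t, has_deriv x t (F t (x t)).

Definition evolution_operator {X : NormedSpace} (A : R -> X -> X)
    (T : R -> R -> X -> X) : Prop :=
  (forall s v, T s s v = v) /\
  (forall s v, is_solution A (fun t => T t s v)) /\
  (forall x, is_solution A x -> forall t s, T t s (x s) = x t).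

Definition growth_rate (u : R -> R) : Prop :=
  (forall s t, s < t -> u s < u t) /\
  (forall t, 0 < u t) /\
  u 0 = 1 /\
  (forall M, exists N, forall t, t > N -> u t > M) /\
  (forall e, 0 < e -> exists N, forall t, t < N -> u t < e).

Definition nonuniform_dichotomy {X : NormedSpace} (T : R -> R -> X -> X)
    (h k mu nu : R -> R) (a b eps K : R) : Prop :=
  exists P : R -> X -> X,
    (forall t, bounded_linear (P t) /\ forall x, P t (P t x) = P t x) /\
    (forall t s x, P t (T t s x) = T t s (P s x)) /\
    (forall t s, s <= t -> forall x,
        ns_norm (T t s (P s x))
          <= K * Rpower (h t / h s) a * Rpower (mu (Rabs s)) eps * ns_norm x) /\
    (forall t s, t <= s -> forall x,
        ns_norm (T t s (ns_sub x (P s x)))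
          <= K * Rpower (k s / k t) (- b) * Rpower (nu (Rabs s)) eps * ns_norm x).

Definition norm_coercive {X : NormedSpace} (G : R -> X -> X) : Prop :=
  forall M, exists N, forall t x, ns_norm x > N -> ns_norm (G t x) > M.

Definition topological_equivalence {X : NormedSpace} (A f : R -> X -> X)
    (H : R -> X -> X) : Prop :=
  norm_coercive H /\
  (exists L : R -> X -> X,
     (forall t, continuous_map (H t) /\ continuous_map (L t) /\
                (forall x, L t (H t x) = x) /\ (forall y, H t (L t y) = y)) /\
     norm_coercive L) /\
  (forall x, is_solution (fun t v => ns_add (A t v) (f t v)) x ->
     is_solution A (fun t => H t (x t))).

(* Main.v *)
Require Import Defs.
From Stdlib Require Import Reals Lra Lia List.
From Stdlib Require Import Classical ClassicalEpsilon FunctionalExtensionality PropExtensionality.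
From Coquelicot Require Import Coquelicot.
Open Scope R_scope.

(** Write [P], [Q] for the dichotomy projections at time 0. A solution [x] of the perturbed equation
    shadows a solution [ell] of the linear one when [w(t) = T(0,t) (x(t) - ell(t))], whose
    derivative is [T(0,t) f(t,x(t))], satisfies [P w -> 0] at -oo and [Q w -> 0] at +oo; equivalently,
    [x - ell] is the Green operator of the dichotomy applied to [f(.,x)]. Since
    [h'/h = (ln h)'] and [k'/k = (ln k)'], the exponential weights integrate exactly and the Green
    operator has norm [K (1/|a| + 1/b)] on forcings dominated by the minimum in the hypotheses. Hence
    every [x] shadows exactly one [ell], and, by the contraction principle, every [ell] is shadowed by
    exactly one [x]; [H] and its inverse evaluate this bijection at a given time. Continuity comes
    from Gronwall's inequality on a large compact window, the rest of the line contributing little.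
    As [h'] and [k'] need not be integrable, integrals of majorants are replaced throughout by
    mean value inequalities against their primitives. *)

(** The weights [mu^(-eps)] and [nu^(-eps)] in the bounds on [f] cancel the nonuniform factors of
    the dichotomy at the time where the forcing acts. For a forcing bounded by [D] times the
    minimum, the stable Green integrand at [u <= t] is then at most [K D exp(|a| (ln h(u) - ln
    h(t))) (ln h)'(u)], an exact derivative whose integral over [u <= t] is [K D / |a|] for every
    [t]; the unstable side gives [K D / b] in the same way. Hence the constants of the statement.
    Pairing whole curves, with no base time, makes property (iv) a matter of uniqueness: the pair
    attached to one point of a solution is attached to all its points. The two directions of
    continuity are not alike. Perturbed solutions close at one time are close on any compact window,
    and one use of the contraction estimate suffices. Linear solutions close at one time may diverge
    at infinity, so the fixed points attached to them cannot be compared in the supremum norm;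
    finitely many windows, nested outwards, replace it. *)

Local Notation "x ⊕ y" := (ns_add x y) (at level 50, left associativity).
Local Notation "x ⊖ y" := (ns_sub x y) (at level 50, left associativity).
Local Notation "c ⊙ x" := (ns_scal c x) (at level 40, left associativity).
Local Notation "⟦ x ⟧" := (ns_norm x) (at level 0, x at level 99, format "⟦ x ⟧").
Local Notation "0v" := ns_zero.

(** * Linear algebra in a normed space *)

(* Syntax for the reflexive tactic [vec], which compares the coefficients of the atoms. *)
Inductive vexpr :=
| VVar (n : nat) | VZero | VAdd (e1 e2 : vexpr) | VOpp (e : vexpr) | VScal (c : R) (e : vexpr).

Fixpoint veval (X : NormedSpace) (env : list X) (e : vexpr) : X :=
  match e with
  | VVar n => nth n env 0v
  | VZero => 0v
  | VAdd e1 e2 => veval X env e1 ⊕ veval X env e2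
  | VOpp e => ns_opp (veval X env e)
  | VScal c e => c ⊙ veval X env e
  end.

Fixpoint vcoef (e : vexpr) (i : nat) : R :=
  match e with
  | VVar n => if Nat.eqb n i then 1 else 0
  | VZero => 0
  | VAdd e1 e2 => vcoef e1 i + vcoef e2 i
  | VOpp e => - vcoef e i
  | VScal c e => c * vcoef e i
  end.

Fixpoint lincomb (X : NormedSpace) (c : nat -> R) (env : list X) : X :=
  match env with
  | nil => 0v
  | x :: l => c 0%nat ⊙ x ⊕ lincomb X (fun i => c (S i)) l
  end.

(** Recursive rather than quantified over [i < n], so that [simpl] turns it into a finite
    conjunction of ring identities. *)
Fixpoint coefs_eq (c1 c2 : nat -> R) (n : nat) : Prop :=
  match n with O => True | S n => c1 n = c2 n /\ coefs_eq c1 c2 n end.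

Section Algebra.
Variable X : NormedSpace.
Implicit Types x y z : X.

Lemma ns_addr0 x : x ⊕ 0v = x.
Proof. rewrite ns_addC; apply ns_add0. Qed.

Lemma ns_add_inj z x y : z ⊕ x = z ⊕ y -> x = y.
Proof.
  intros E. rewrite <- (ns_add0 _ x), <- (ns_add0 _ y), <- (ns_addN _ z), (ns_addC _ z (ns_opp z)).
  now rewrite <- !ns_addA, E.
Qed.

Lemma ns_scal0 x : 0 ⊙ x = 0v.
Proof.
  apply (ns_add_inj x). rewrite ns_addr0.
  rewrite <- (ns_scal1 _ x) at 1. rewrite <- ns_scalDl, Rplus_0_r. apply ns_scal1.
Qed.

Lemma ns_scalr0 c : c ⊙ (0v : X) = 0v.
Proof. rewrite <- (ns_scal0 0v), ns_scalA. now rewrite Rmult_0_r. Qed.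

Lemma ns_oppE x : ns_opp x = (-1) ⊙ x.
Proof.
  apply (ns_add_inj x). rewrite ns_addN.
  rewrite <- (ns_scal1 _ x) at 1. rewrite <- ns_scalDl.
  replace (1 + -1) with 0 by ring. now rewrite ns_scal0.
Qed.

Lemma ns_addACA (a b c d : X) : (a ⊕ b) ⊕ (c ⊕ d) = (a ⊕ c) ⊕ (b ⊕ d).
Proof. rewrite !ns_addA. f_equal. rewrite <- !ns_addA. f_equal. apply ns_addC. Qed.

Lemma lincomb_ext c1 c2 (env : list X) :
  coefs_eq c1 c2 (length env) -> lincomb X c1 env = lincomb X c2 env.
Proof.
  intros E. assert (E' : forall i, (i < length env)%nat -> c1 i = c2 i).
  { revert E. generalize (length env). induction n; simpl; [lia|].
    intros [E1 E2] i Hi. destruct (Nat.eq_dec i n); [now subst|apply IHn; [auto|lia]]. }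
  clear E. revert c1 c2 E'. induction env as [|x l IH]; simpl; intros; [auto|].
  rewrite E' by lia. f_equal. apply IH. intros; apply E'; lia.
Qed.

Lemma lincomb_add c1 c2 (env : list X) :
  lincomb X (fun i => c1 i + c2 i) env = lincomb X c1 env ⊕ lincomb X c2 env.
Proof.
  revert c1 c2; induction env as [|x l IH]; simpl; intros; [now rewrite ns_add0|].
  now rewrite ns_addACA, <- IH, ns_scalDl.
Qed.

Lemma lincomb_scal c c1 (env : list X) :
  lincomb X (fun i => c * c1 i) env = c ⊙ lincomb X c1 env.
Proof.
  revert c1; induction env as [|x l IH]; simpl; intros; [now rewrite ns_scalr0|].
  now rewrite ns_scalDr, <- IH, ns_scalA.
Qed.

Lemma lincomb_0 (env : list X) : lincomb X (fun _ => 0) env = 0v.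
Proof.
  induction env as [|x l IH]; simpl; intros; [easy|]. now rewrite IH, ns_scal0, ns_add0.
Qed.

Lemma veval_lincomb env e : veval X env e = lincomb X (vcoef e) env.
Proof.
  induction e; simpl.
  - revert n; induction env as [|x l IH]; intros [|n]; simpl; auto.
    + rewrite lincomb_0, ns_addr0. symmetry; apply ns_scal1.
    + now rewrite ns_scal0, ns_add0, IH.
  - now rewrite lincomb_0.
  - now rewrite lincomb_add, IHe1, IHe2.
  - rewrite ns_oppE, IHe, <- lincomb_scal. f_equal. extensionality i; ring.
  - now rewrite lincomb_scal, IHe.
Qed.

Lemma veval_eq env e1 e2 :
  coefs_eq (vcoef e1) (vcoef e2) (length env) -> veval X env e1 = veval X env e2.
Proof. intros E. rewrite !veval_lincomb. now apply lincomb_ext. Qed.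

End Algebra.

Ltac vec_mem x l :=
  match l with
  | nil => constr:(false) | x :: _ => constr:(true) | _ :: ?l => vec_mem x l
  end.
Ltac vec_index x l :=
  match l with
  | x :: _ => constr:(O) | _ :: ?l => let n := vec_index x l in constr:(S n)
  end.
Ltac vec_atoms e l :=
  lazymatch e with
  | ns_add ?a ?b => let l := vec_atoms a l in vec_atoms b l
  | ns_sub ?a ?b => let l := vec_atoms a l in vec_atoms b l
  | ns_opp ?a => vec_atoms a l
  | ns_scal _ ?a => vec_atoms a l
  | ns_zero => l
  | ?x => let m := vec_mem x l in
          match m with true => l | false => constr:(x :: l) end
  end.
Ltac vec_quote e l :=
  lazymatch e with
  | ns_add ?a ?b => let p := vec_quote a l in let q := vec_quote b l in constr:(VAdd p q)
  | ns_sub ?a ?b => let p := vec_quote a l in let q := vec_quote b l in constr:(VAdd p (VOpp q))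
  | ns_opp ?a => let p := vec_quote a l in constr:(VOpp p)
  | ns_scal ?c ?a => let p := vec_quote a l in constr:(VScal c p)
  | ns_zero => constr:(VZero)
  | ?x => let n := vec_index x l in constr:(VVar n)
  end.
Ltac vec :=
  lazymatch goal with
  | |- @eq ?T ?e1 ?e2 =>
    let X := match type of e1 with ns_car ?X => X | _ =>
             match T with ns_car ?X => X end end in
    let l := vec_atoms e1 (@nil (ns_car X)) in
    let l := vec_atoms e2 l in
    let p := vec_quote e1 l in
    let q := vec_quote e2 l in
    (* Reification is checked by conversion, which also unfolds [ns_sub] into the sum with an
       opposite. *)
    change (veval X l p = veval X l q); apply veval_eq; simpl;
    repeat (split; [try ring|]); try exact I
  end.

Section Norm.
Variable X : NormedSpace.
Implicit Types x y z : X.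

Lemma norm_zero : ⟦(0v : X)⟧ = 0.
Proof. rewrite <- (ns_scal0 X 0v), ns_normZ, Rabs_R0; ring. Qed.

Lemma norm_opp x : ⟦ns_opp x⟧ = ⟦x⟧.
Proof. rewrite ns_oppE, ns_normZ, Rabs_left by lra. ring. Qed.

Lemma norm_ge0 x : 0 <= ⟦x⟧.
Proof.
  generalize (ns_normD _ x (ns_opp x)). rewrite ns_addN, norm_zero, norm_opp. lra.
Qed.

Lemma norm_subC x y : ⟦x ⊖ y⟧ = ⟦y ⊖ x⟧.
Proof. rewrite <- norm_opp. f_equal. vec. Qed.

Lemma norm_sub x y : ⟦x ⊖ y⟧ <= ⟦x⟧ + ⟦y⟧.
Proof. unfold ns_sub. rewrite <- (norm_opp y). apply ns_normD. Qed.

Lemma norm_triangle y x z : ⟦x ⊖ z⟧ <= ⟦x ⊖ y⟧ + ⟦y ⊖ z⟧.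
Proof. replace (x ⊖ z) with ((x ⊖ y) ⊕ (y ⊖ z)) by vec. apply ns_normD. Qed.

Lemma norm_le_sub x y : ⟦x⟧ <= ⟦y⟧ + ⟦x ⊖ y⟧.
Proof. replace x with (y ⊕ (x ⊖ y)) at 1 by vec. apply ns_normD. Qed.

Lemma sub_diag x : x ⊖ x = 0v.
Proof. vec. Qed.

Lemma norm_sub_diag x : ⟦x ⊖ x⟧ = 0.
Proof. rewrite sub_diag; apply norm_zero. Qed.

Lemma norm_sub_eq0 x y : ⟦x ⊖ y⟧ = 0 -> x = y.
Proof.
  intros E. apply ns_norm_eq0 in E. replace x with ((x ⊖ y) ⊕ y) by vec.
  rewrite E. vec.
Qed.

End Norm.

(** * Curves: derivatives, comparison, mean value inequality *)

Definition curve_cont_at {X : NormedSpace} (x : R -> X) (t : R) : Prop :=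
  forall e, 0 < e -> exists d, 0 < d /\ forall s, Rabs (s - t) < d -> ⟦x s ⊖ x t⟧ < e.

Section Curves.
Variable X : NormedSpace.
Implicit Types (x y : R -> X) (u v : X).

Lemma has_deriv_cont x t v : has_deriv x t v -> curve_cont_at x t.
Proof.
  intros D e He. destruct (D 1 Rlt_0_1) as [d [Hd D1]].
  pose proof (norm_ge0 X v) as Hv.
  exists (Rmin d (e / (2 + ⟦v⟧))). split.
  { apply Rmin_glb_lt; auto. apply Rdiv_lt_0_compat; lra. }
  intros s Hs. destruct (Req_dec s t) as [->|Hst].
  { now rewrite norm_sub_diag. }
  assert (H1 := Rlt_le_trans _ _ _ Hs (Rmin_l _ _)).
  assert (H2 := Rlt_le_trans _ _ _ Hs (Rmin_r _ _)).
  specialize (D1 (s - t) ltac:(lra) H1).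
  replace (t + (s - t)) with s in D1 by ring.
  assert (H3 := norm_le_sub X (x s ⊖ x t) ((s - t) ⊙ v)). rewrite ns_normZ in H3.
  apply (Rmult_lt_compat_r (2 + ⟦v⟧)) in H2; [|lra].
  replace (e / (2 + ⟦v⟧) * (2 + ⟦v⟧)) with e in H2 by (field; lra).
  assert (0 < Rabs (s - t)) by (apply Rabs_pos_lt; lra). nra.
Qed.

Lemma has_deriv_const v t : has_deriv (fun _ => v) t 0v.
Proof.
  intros e He. exists 1; split; [lra|]. intros r _ _.
  replace (v ⊖ v ⊖ r ⊙ 0v) with (0v : X) by vec. rewrite norm_zero.
  apply Rmult_le_pos; [lra|apply Rabs_pos].
Qed.

Lemma has_deriv_add x y t u v :
  has_deriv x t u -> has_deriv y t v -> has_deriv (fun t => x t ⊕ y t) t (u ⊕ v).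
Proof.
  intros Dx Dy e He.
  destruct (Dx (e / 2) ltac:(lra)) as [d1 [Hd1 D1]].
  destruct (Dy (e / 2) ltac:(lra)) as [d2 [Hd2 D2]].
  exists (Rmin d1 d2). split; [now apply Rmin_glb_lt|]. intros r Hr Hrd.
  specialize (D1 r Hr (Rlt_le_trans _ _ _ Hrd (Rmin_l _ _))).
  specialize (D2 r Hr (Rlt_le_trans _ _ _ Hrd (Rmin_r _ _))).
  replace (_ ⊖ _ ⊖ _) with
    ((x (t + r) ⊖ x t ⊖ r ⊙ u) ⊕ (y (t + r) ⊖ y t ⊖ r ⊙ v)) by vec.
  eapply Rle_trans; [apply ns_normD|]. lra.
Qed.

Lemma has_deriv_lin (L : X -> X) x t v : bounded_linear L ->
  has_deriv x t v -> has_deriv (fun t => L (x t)) t (L v).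
Proof.
  intros [LA [LS [C LC]]] D e He.
  assert (HC : 0 < Rabs C + 1) by (pose proof (Rabs_pos C); lra).
  destruct (D (e / (Rabs C + 1))) as [d [Hd D1]]; [now apply Rdiv_lt_0_compat|].
  exists d; split; auto. intros r Hr Hrd. specialize (D1 r Hr Hrd).
  replace (L (x (t + r)) ⊖ L (x t) ⊖ r ⊙ L v) with (L (x (t + r) ⊖ x t ⊖ r ⊙ v)).
  2:{ unfold ns_sub. rewrite !LA, !ns_oppE, !LS. reflexivity. }
  eapply Rle_trans; [apply LC|].
  pose proof (norm_ge0 X (x (t + r) ⊖ x t ⊖ r ⊙ v)) as Hn.
  pose proof (Rle_abs C).
  apply Rle_trans with ((Rabs C + 1) * (e / (Rabs C + 1) * Rabs r)); [nra|].
  apply Req_le; field; lra.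
Qed.

Lemma bounded_linear_opp : bounded_linear (@ns_opp X).
Proof.
  repeat split; intros; try vec. exists 1. intros u. rewrite norm_opp; lra.
Qed.

Lemma bounded_linear_sub (L M : X -> X) : bounded_linear L -> bounded_linear M ->
  bounded_linear (fun u => L u ⊖ M u).
Proof.
  intros [LA [LS [C LC]]] [MA [MS [D MD]]]. repeat split; intros.
  - rewrite LA, MA. vec.
  - rewrite LS, MS. vec.
  - exists (C + D). intros x. eapply Rle_trans; [apply norm_sub|].
    specialize (LC x); specialize (MD x). lra.
Qed.

Lemma bounded_linear_id : bounded_linear (fun u : X => u).
Proof. repeat split; auto. exists 1; intros; lra. Qed.

Lemma has_deriv_sub x y t u v :
  has_deriv x t u -> has_deriv y t v -> has_deriv (fun t => x t ⊖ y t) t (u ⊖ v).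
Proof.
  intros Dx Dy. apply (has_deriv_add x (fun t => ns_opp (y t)) t u (ns_opp v)); auto.
  apply has_deriv_lin; auto. apply bounded_linear_opp.
Qed.

Lemma has_deriv_subr x c t v : has_deriv x t v -> has_deriv (fun t => x t ⊖ c) t v.
Proof.
  intros D. replace v with (v ⊖ 0v) by vec.
  apply has_deriv_sub; auto. apply has_deriv_const.
Qed.

Lemma has_deriv_rev x t v :
  has_deriv x (- t) v -> has_deriv (fun s => x (- s)) t (ns_opp v).
Proof.
  intros D e He. destruct (D e He) as [d [Hd D1]]. exists d; split; auto.
  intros r Hr Hrd. specialize (D1 (- r)). rewrite Rabs_Ropp in D1.
  replace (- (t + r)) with (- t + - r) by ring.
  replace (r ⊙ ns_opp v) with ((- r) ⊙ v) by vec. apply D1; auto. lra.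
Qed.

Lemma curve_cont_add x y t :
  curve_cont_at x t -> curve_cont_at y t -> curve_cont_at (fun t => x t ⊕ y t) t.
Proof.
  intros Cx Cy e He.
  destruct (Cx (e / 2) ltac:(lra)) as [d1 [Hd1 D1]].
  destruct (Cy (e / 2) ltac:(lra)) as [d2 [Hd2 D2]].
  exists (Rmin d1 d2). split; [now apply Rmin_glb_lt|]. intros r Hrd.
  specialize (D1 r (Rlt_le_trans _ _ _ Hrd (Rmin_l _ _))).
  specialize (D2 r (Rlt_le_trans _ _ _ Hrd (Rmin_r _ _))).
  replace (_ ⊖ _) with ((x r ⊖ x t) ⊕ (y r ⊖ y t)) by vec.
  eapply Rle_lt_trans; [apply ns_normD|]. lra.
Qed.

Lemma curve_cont_joint (f : R -> X -> X) x t : jointly_continuous f ->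
  curve_cont_at x t -> curve_cont_at (fun t => f t (x t)) t.
Proof.
  intros Cf Cx e He. destruct (Cf t (x t) e He) as [d [Hd D]].
  destruct (Cx d Hd) as [d1 [Hd1 D1]].
  exists (Rmin d d1). split; [now apply Rmin_glb_lt|]. intros s Hs. apply D.
  - exact (Rlt_le_trans _ _ _ Hs (Rmin_l _ _)).
  - apply D1. exact (Rlt_le_trans _ _ _ Hs (Rmin_r _ _)).
Qed.

Lemma derivable_pt_lim_bound (g : R -> R) t l : derivable_pt_lim g t l ->
  forall e, 0 < e -> exists d, 0 < d /\ forall r, Rabs r < d ->
    Rabs (g (t + r) - g t - r * l) <= e * Rabs r.
Proof.
  intros D e He. destruct (D e He) as [[d Hd] D1]. exists d; split; auto.
  intros r Hrd. destruct (Req_dec r 0) as [->|Hr].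
  { rewrite Rplus_0_r, Rabs_R0. replace (_ - _ - _) with 0 by ring. rewrite Rabs_R0; lra. }
  specialize (D1 r Hr Hrd).
  replace (g (t + r) - g t - r * l) with (((g (t + r) - g t) / r - l) * r) by (field; auto).
  rewrite Rabs_mult. apply Rmult_le_compat_r; [apply Rabs_pos|lra].
Qed.

(** Induction along an interval: the supremum of the times up to which [Pr] holds is reached by the
    closedness hypothesis, and if it were below [T] the openness hypothesis would push it
    further. *)
Lemma real_induction (Pr : R -> Prop) s T : s <= T ->
  (forall t, s <= t <= T -> (forall r, s <= r < t -> Pr r) -> Pr t) ->
  (forall t, s <= t < T -> Pr t ->
     exists d, 0 < d /\ forall r, t < r < t + d -> r <= T -> Pr r) ->
  forall t, s <= t <= T -> Pr t.
Proof.
  intros HsT Hcl Hop.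
  set (E := fun t => s <= t <= T /\ forall r, s <= r <= t -> Pr r).
  assert (Es : E s).
  (* At [t = s] the premise of [Hcl] is vacuous, which makes it the base case as well. *)
  { split; [lra|]. intros r Hr. apply Hcl; [lra|]. intros; lra. }
  destruct (completeness E) as [m [Hub Hlub]].
  { exists T. intros t [Ht _]; lra. }
  { now exists s. }
  assert (Hsm : s <= m) by now apply Hub.
  assert (HmT : m <= T) by (apply Hlub; intros t [Ht _]; lra).
  assert (Hbelow : forall r, s <= r < m -> Pr r).
  { intros r Hr. apply NNPP; intros Hn.
    assert (m <= r); [|lra]. apply Hlub. intros t [Ht Ht'].
    apply Rnot_lt_le; intros Hlt. apply Hn, Ht'. lra. }
  assert (Hm : Pr m) by (apply Hcl; auto).
  assert (Em : forall r, s <= r <= m -> Pr r).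
  { intros r Hr. destruct (Req_dec r m) as [->|]; auto. apply Hbelow; lra. }
  destruct (Req_dec m T) as [->|HmT']; [exact Em|exfalso].
  destruct (Hop m ltac:(lra) Hm) as [d [Hd D]].
  assert (EE : E (Rmin T (m + d / 2))).
  { assert (A1 := Rmin_l T (m + d / 2)). assert (A2 := Rmin_r T (m + d / 2)). split.
    - split; auto. apply Rmin_glb; lra.
    - intros r Hr. destruct (Rle_dec r m); [apply Em; lra|apply D; lra]. }
  apply Hub in EE. revert EE. apply Rlt_not_le. apply Rmin_glb_lt; lra.
Qed.

(** Barrier argument by real induction: continuity carries the bound to limit times, and the strict
    inequality of the derivatives carries it a little further. The derivative bound is asked for
    only below the barrier, so that it may depend on the size of [x], as Gronwall's inequality
    requires. *)
Lemma norm_comparison x dx (phi dphi : R -> R) s T : s <= T ->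
  (forall t, s <= t <= T -> has_deriv x t (dx t)) ->
  (forall t, s <= t <= T -> derivable_pt_lim phi t (dphi t)) ->
  ⟦x s⟧ <= phi s ->
  (forall t, s <= t <= T -> ⟦x t⟧ <= phi t -> ⟦dx t⟧ < dphi t) ->
  ⟦x T⟧ <= phi T.
Proof.
  intros HsT Dx Dp H0 Hd.
  apply (real_induction (fun t => ⟦x t⟧ <= phi t) s T); auto; [| |lra].
  - intros t Ht Hlt. destruct (Req_dec t s) as [->|Hts]; auto.
    apply Rnot_lt_le; intros Hgt. set (e := ⟦x t⟧ - phi t).
    assert (He : 0 < e / 4) by (unfold e; lra).
    destruct (has_deriv_cont _ _ _ (Dx t Ht) _ He) as [d1 [Hd1 C1]].
    assert (Cp : continuity_pt phi t) by (apply derivable_continuous_pt; exists (dphi t); now apply Dp).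
    destruct (Cp (e / 4) He) as [d2 [Hd2 C2]].
    set (r := Rmax s (t - Rmin d1 d2 / 2)).
    assert (Hm : 0 < Rmin d1 d2) by (apply Rmin_glb_lt; auto; lra).
    assert (Hr : s <= r < t).
    { unfold r. split; [apply Rmax_l|]. apply Rmax_lub_lt; lra. }
    assert (Hr2 : t - r < Rmin d1 d2) by (unfold r; pose proof (Rmax_r s (t - Rmin d1 d2 / 2)); lra).
    pose proof (Rmin_l d1 d2). pose proof (Rmin_r d1 d2).
    assert (Ha : Rabs (r - t) = t - r) by (rewrite Rabs_left; lra).
    specialize (C1 r ltac:(lra)).
    assert (C3 : Rabs (phi r - phi t) < e / 4).
    { apply C2. split; [split; [exact I|lra]|]. simpl. unfold R_dist, Rdist. lra. }
    apply Rabs_def2 in C3. specialize (Hlt r Hr).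
    assert (C4 := norm_le_sub X (x t) (x r)). rewrite norm_subC in C4. unfold e in *. lra.
  - intros t Ht Hle. specialize (Hd t ltac:(lra) Hle).
    (* Half of the gap: the linearisation errors of [x] and of [phi] use up one [e] each. *)
    set (e := (dphi t - ⟦dx t⟧) / 2). assert (He : 0 < e) by (unfold e; lra).
    destruct (Dx t ltac:(lra) e He) as [d1 [Hd1 C1]].
    destruct (derivable_pt_lim_bound _ _ _ (Dp t ltac:(lra)) e He) as [d2 [Hd2 C2]].
    exists (Rmin d1 d2). split; [now apply Rmin_glb_lt|]. intros r Hr HrT.
    pose proof (Rmin_l d1 d2). pose proof (Rmin_r d1 d2).
    assert (Ha : Rabs (r - t) = r - t) by (rewrite Rabs_right; lra).
    specialize (C1 (r - t) ltac:(lra) ltac:(lra)).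
    specialize (C2 (r - t) ltac:(lra)).
    replace (t + (r - t)) with r in * by ring. rewrite Ha in *.
    assert (C3 := norm_le_sub X (x r ⊖ x t) ((r - t) ⊙ dx t)).
    rewrite ns_normZ, Ha in C3.
    assert (C4 := norm_le_sub X (x r) (x t)).
    apply Rabs_le_between in C2.
    assert ((r - t) * dphi t = (r - t) * ⟦dx t⟧ + 2 * (e * (r - t))) by (unfold e; field).
    lra.
Qed.

Lemma le_of_le_eps a b c : 0 <= c -> (forall e, 0 < e -> a <= b + e * c) -> a <= b.
Proof.
  intros Hc H. apply Rnot_lt_le; intros Hlt.
  specialize (H ((a - b) / (2 * (c + 1)))).
  assert (0 < (a - b) / (2 * (c + 1))) by (apply Rdiv_lt_0_compat; lra).
  specialize (H H0).
  assert ((a - b) / (2 * (c + 1)) * (2 * (c + 1)) = a - b) by (field; lra). nra.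
Qed.

(* Only the majorant's primitive [g] is needed; [dg] itself need not be integrable. *)
Lemma mean_value_ineq x dx (g dg : R -> R) s T : s <= T ->
  (forall t, s <= t <= T -> has_deriv x t (dx t)) ->
  (forall t, s <= t <= T -> derivable_pt_lim g t (dg t)) ->
  (forall t, s <= t <= T -> ⟦dx t⟧ <= dg t) ->
  ⟦x T ⊖ x s⟧ <= g T - g s.
Proof.
  intros HsT Dx Dg Hd. apply le_of_le_eps with (T - s); [lra|]. intros e He.
  (* The extra slope [e] makes the comparison of derivatives strict. *)
  apply (norm_comparison (fun t => x t ⊖ x s) dx
    (fun t => (g t - g s) + e * (t - s)) (fun t => dg t + e) s T HsT).
  - intros t Ht. apply has_deriv_subr; auto.
  - intros t Ht. apply is_derive_Reals.
    assert (D := Dg t Ht). apply is_derive_Reals in D.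
    evar_last.
    apply (is_derive_plus (fun t => g t - g s) (fun t => e * (t - s))).
    + apply (is_derive_minus g (fun _ => g s)); [exact D|apply is_derive_const].
    + auto_derive; auto.
    + unfold plus, minus, opp, plus, zero; simpl. ring.
  - rewrite norm_sub_diag. lra.
  - intros t Ht _. specialize (Hd t Ht). lra.
Qed.

Lemma gronwall x dx (g dg : R -> R) s T : s <= T ->
  (forall t, has_deriv x t (dx t)) ->
  (forall t, derivable_pt_lim g t (dg t)) ->
  (forall t, 0 <= dg t) ->
  (forall t, ⟦dx t⟧ <= dg t * ⟦x t⟧) ->
  ⟦x T⟧ <= exp (g T - g s) * ⟦x s⟧.
Proof.
  intros HsT Dx Dg Hp Hd.
  apply le_of_le_eps with ((T - s) * exp (g T - g s)).
  { apply Rmult_le_pos; [lra|left; apply exp_pos]. }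
  intros e He.
  replace (_ + _) with ((⟦x s⟧ + e * (T - s)) * exp (g T - g s)) by ring.
  (* The Gronwall barrier with its constant growing at rate [e], so that its derivative strictly
     exceeds [dg] times the barrier. *)
  apply (norm_comparison x dx
    (fun t => (⟦x s⟧ + e * (t - s)) * exp (g t - g s))
    (fun t => e * exp (g t - g s) + (⟦x s⟧ + e * (t - s)) * exp (g t - g s) * dg t) s T HsT); auto.
  - intros t Ht. apply is_derive_Reals.
    assert (D := Dg t). apply is_derive_Reals in D.
    evar_last.
    apply (is_derive_mult (fun t => ⟦x s⟧ + e * (t - s)) (fun t => exp (g t - g s))).
    + auto_derive; [auto|reflexivity].
    + apply (is_derive_comp exp (fun t => g t - g s)).
      * apply is_derive_exp.
      * apply (is_derive_minus g (fun _ => g s)); [exact D|apply is_derive_const].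
    + intros; apply Rmult_comm.
    + unfold plus, minus, opp, plus, zero, mult, scal; simpl. unfold mult; simpl. ring.
  - replace (g s - g s) with 0 by ring. rewrite exp_0. lra.
  - intros t Ht Hle. specialize (Hd t).
    apply Rle_lt_trans with (1 := Hd). specialize (Hp t).
    assert (0 < e * exp (g t - g s)) by (apply Rmult_lt_0_compat; auto; apply exp_pos). nra.
Qed.

Lemma derivable_rev (g : R -> R) t l : derivable_pt_lim g (- t) l ->
  derivable_pt_lim (fun s => - g (- s)) t l.
Proof.
  intros D. apply is_derive_Reals in D. apply is_derive_Reals.
  evar_last. apply (is_derive_opp (fun s => g (- s))).
  apply (is_derive_comp g (fun s => - s)); [exact D|].
  auto_derive; [auto|reflexivity].
  unfold opp, scal; simpl. unfold mult; simpl. ring.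
Qed.

(** Backward in time, the reversed curve satisfies the same inequality with primitive
    [- g (- r)]. *)
Lemma gronwall_abs x dx (g dg : R -> R) s t :
  (forall t, has_deriv x t (dx t)) ->
  (forall t, derivable_pt_lim g t (dg t)) ->
  (forall t, 0 <= dg t) ->
  (forall t, ⟦dx t⟧ <= dg t * ⟦x t⟧) ->
  ⟦x t⟧ <= exp (Rabs (g t - g s)) * ⟦x s⟧.
Proof.
  intros Dx Dg Hp Hd.
  assert (Hw : forall r c, ⟦x t⟧ <= exp r * c -> 0 <= c -> ⟦x t⟧ <= exp (Rabs r) * c).
  { intros r c H Hc. apply Rle_trans with (1 := H). apply Rmult_le_compat_r; auto.
    destruct (Rle_lt_or_eq_dec _ _ (Rle_abs r)) as [Hl| <-]; [|lra].
    left; now apply exp_increasing. }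
  destruct (Rle_dec s t) as [Hst|Hst].
  - apply Hw; [|apply norm_ge0]. eapply gronwall; eauto.
  - rewrite Rabs_minus_sym. apply Hw; [|apply norm_ge0].
    assert (G := gronwall (fun r => x (- r)) (fun r => ns_opp (dx (- r)))
      (fun r => - g (- r)) (fun r => dg (- r)) (- s) (- t)).
    cbv beta in G. rewrite !Ropp_involutive in G.
    replace (g s - g t) with (- g t - - g s) by ring. apply G; auto; [lra| | |].
    + intros r. apply has_deriv_rev, Dx.
    + intros r. apply derivable_rev, Dg.
    + intros r. rewrite norm_opp. apply Hd.
Qed.

End Curves.

Lemma functional_choice {A B : Type} (R : A -> B -> Prop) :
  (forall x, exists y, R x y) -> exists g : A -> B, forall x, R x (g x).
Proof.
  intros H. exists (fun x => proj1_sig (constructive_indefinite_description _ (H x))).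
  intros x. apply proj2_sig.
Qed.

(** * Primitives of continuous curves in a Banach space *)

Section Primitives.
Variable X : NormedSpace.
Hypothesis HX : complete X.

(* A Coquelicot structure on the space, for the sake of its vector-valued Riemann integral. *)
Definition ns_AbelianMonoid_mixin :=
  AbelianMonoid.Mixin X ns_add ns_zero (ns_addC X) (ns_addA X) (ns_addr0 X).
Definition ns_AbelianGroup_mixin :=
  AbelianGroup.Mixin (AbelianMonoid.Pack X ns_AbelianMonoid_mixin X) ns_opp (ns_addN X).
Definition ns_AbelianGroup_class := AbelianGroup.Class X ns_AbelianMonoid_mixin ns_AbelianGroup_mixin.

Definition ns_ball (x : X) (e : R) (y : X) : Prop := ⟦y ⊖ x⟧ < e.

Lemma ns_ball_center x (e : posreal) : ns_ball x e x.
Proof. unfold ns_ball. rewrite norm_sub_diag. apply cond_pos. Qed.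

Lemma ns_ball_sym x y e : ns_ball x e y -> ns_ball y e x.
Proof. unfold ns_ball. now rewrite norm_subC. Qed.

Lemma ns_ball_triangle x y z e1 e2 : ns_ball x e1 y -> ns_ball y e2 z -> ns_ball x (e1 + e2) z.
Proof.
  unfold ns_ball. intros H1 H2. generalize (norm_triangle X y z x). lra.
Qed.

Definition ns_UniformSpace_mixin :=
  UniformSpace.Mixin X ns_zero ns_ball ns_ball_center ns_ball_sym ns_ball_triangle.

Definition ns_ModuleSpace_mixin :=
  ModuleSpace.Mixin R_AbsRing (AbelianGroup.Pack X ns_AbelianGroup_class X)
    ns_scal (ns_scalA X) (ns_scal1 X) (ns_scalDr X) (ns_scalDl X).
Definition ns_ModuleSpace_class :=
  ModuleSpace.Class R_AbsRing X ns_AbelianGroup_class ns_ModuleSpace_mixin.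
Definition ns_NormedModuleAux_class :=
  NormedModuleAux.Class R_AbsRing X ns_ModuleSpace_class ns_UniformSpace_mixin.

Lemma ns_norm_scal_le (c : R) (x : X) : ⟦c ⊙ x⟧ <= Rabs c * ⟦x⟧.
Proof. rewrite ns_normZ; lra. Qed.

Lemma ns_norm_ball (x y : X) (e : R) : ⟦y ⊖ x⟧ < e -> ns_ball x e y.
Proof. easy. Qed.

Lemma ns_ball_norm (x y : X) (e : posreal) : ns_ball x e y -> ⟦y ⊖ x⟧ < 1 * e.
Proof. unfold ns_ball; lra. Qed.

Definition ns_NormedModule_mixin :=
  NormedModule.Mixin R_AbsRing (NormedModuleAux.Pack R_AbsRing X ns_NormedModuleAux_class X)
    ns_norm 1 (ns_normD X) ns_norm_scal_le ns_norm_ball ns_ball_norm (ns_norm_eq0 X).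
Definition ns_NormedModule_class :=
  NormedModule.Class R_AbsRing X ns_NormedModuleAux_class ns_NormedModule_mixin.

Let U : UniformSpace := UniformSpace.Pack X ns_UniformSpace_mixin X.

(** The limit operator must be total on families of sets: [epsilon] picks a limit whenever one
    exists, and [0v] only witnesses inhabitation. *)
Definition ns_lim (F : (U -> Prop) -> Prop) : U :=
  epsilon (inhabits (ns_zero : X)) (fun l : U => forall e : posreal, F (ball l e)).

(** Reduces filters to sequences: choose centres of balls of radius [1/(n+1)] lying in the filter.
    Any two of these balls meet because the filter is proper, so the centres form a Cauchy sequence,
    and its limit is a limit of the filter. *)
Lemma ns_lim_ball (F : (U -> Prop) -> Prop) : ProperFilter F -> cauchy F ->
  forall e : posreal, F (ball (ns_lim F) e).
Proof.
  intros PF CF. unfold ns_lim. apply epsilon_spec.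
  set (rad := fun n : nat => mkposreal (/ (INR n + 1)) (RinvN_pos n)).
  destruct (functional_choice (fun n (x : U) => F (ball x (rad n)))) as [u Hu].
  { intros n. apply CF. }
  destruct (HX u) as [l Hl].
  { intros e He. destruct (Rcomplements.nfloor_ex (2 / e)) as [N HN].
    { left; apply Rdiv_lt_0_compat; lra. }
    assert (Hr : forall n, (S N <= n)%nat -> rad n < e / 2).
    { intros n Hn. simpl. apply le_INR in Hn. rewrite S_INR in Hn.
      replace (e / 2) with (/ (2 / e)) by (field; lra).
      apply Rinv_lt_contravar; [|lra]. apply Rmult_lt_0_compat.
      apply Rdiv_lt_0_compat; lra. pose proof (pos_INR N). lra. }
    exists (S N). intros m n Hm Hn.
    destruct (filter_ex _ (filter_and _ _ (Hu m) (Hu n))) as [z [Z1 Z2]].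
    apply ns_ball_sym in Z1. assert (B := ns_ball_triangle _ _ _ _ _ Z2 Z1).
    unfold ns_ball in B. generalize (Hr m Hm) (Hr n Hn). lra. }
  exists l. intros e. destruct (Hl (e / 2)) as [N HN]; [apply is_pos_div_2|].
  destruct (Rcomplements.nfloor_ex (2 / e)) as [M HM].
  { left; apply Rdiv_lt_0_compat; [lra|apply cond_pos]. }
  set (n := (N + S M)%nat).
  assert (Hr : rad n <= e / 2).
  { simpl. pose proof (cond_pos e). replace (e / 2) with (/ (2 / e)) by (field; lra).
    apply Rinv_le_contravar; [apply Rdiv_lt_0_compat; lra|].
    unfold n. rewrite plus_INR, S_INR. pose proof (pos_INR N). lra. }
  apply (filter_imp (ball (u n) (rad n))); [|apply Hu].
  intros z Hz. replace (pos e) with (e / 2 + e / 2) by field.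
  apply (ns_ball_triangle _ (u n)).
  - apply HN. unfold n; lia.
  - unfold ns_ball. eapply Rlt_le_trans; [exact Hz|exact Hr].
Qed.

(** Filters finer than each other are equal by extensionality, so [epsilon] makes the same choice
    for both. *)
Lemma ns_lim_close (F G : (U -> Prop) -> Prop) :
  filter_le F G -> filter_le G F -> close (ns_lim F) (ns_lim G).
Proof.
  intros FG GF. replace G with F; [intros e; apply ball_center|].
  extensionality P. apply propositional_extensionality. split; auto.
Qed.

Definition ns_CompleteSpace_mixin := CompleteSpace.Mixin U ns_lim ns_lim_ball ns_lim_close.

Definition ns_CompleteNormedModule : CompleteNormedModule R_AbsRing :=
  CompleteNormedModule.Pack R_AbsRing X
    (CompleteNormedModule.Class R_AbsRing X ns_NormedModule_class ns_CompleteSpace_mixin) X.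

Lemma curve_primitive (F : R -> X) : (forall t, curve_cont_at F t) ->
  exists G : R -> X, forall t, has_deriv G t (F t).
Proof.
  intros CF. set (V := ns_CompleteNormedModule).
  assert (CF' : forall t, @continuous R_UniformSpace V F t).
  { intros t P [e He]. destruct (CF t e (cond_pos e)) as [d [Hd D]].
    exists (mkposreal d Hd). intros s Hs. apply He. apply D. exact Hs. }
  exists (fun t => @RInt V F 0 t). intros t e He.
  assert (D : @is_derive R_AbsRing V (fun t => @RInt V F 0 t) t (F t)).
  { apply (@is_derive_RInt V F _ 0); [|apply CF'].
    exists (mkposreal 1 Rlt_0_1). intros s _. apply (@RInt_correct V).
    apply ex_RInt_continuous. intros; apply CF'. }
  destruct D as [_ D].
  destruct (D t (fun P H => H) (mkposreal e He)) as [[d Hd] D1].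
  exists d; split; auto. intros r Hr Hrd.
  assert (Hb : ball t d (t + r)).
  { change (Rabs (t + r - t) < d). now replace (t + r - t) with r by ring. }
  assert (D2 : ⟦@RInt V F 0 (t + r) ⊖ @RInt V F 0 t ⊖ (t + r - t) ⊙ F t⟧ <= e * Rabs (t + r - t))
    by exact (D1 (t + r) Hb).
  replace (t + r - t) with r in D2 by ring. exact D2.
Qed.

End Primitives.

Lemma real_primitive (c : R -> R) : (forall t, continuity_pt c t) ->
  exists C : R -> R, forall t, derivable_pt_lim C t (c t).
Proof.
  intros Hc. assert (CF' : forall t, continuous c t) by (intros t; now apply continuity_pt_filterlim).
  exists (fun t => RInt c 0 t). intros t. apply is_derive_Reals.
  apply (is_derive_RInt c _ 0); [|apply CF'].
  exists (mkposreal 1 Rlt_0_1). intros s _. apply (@RInt_correct R_CompleteNormedModule).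
  apply (@ex_RInt_continuous R_CompleteNormedModule). intros; apply CF'.
Qed.

(** * Weighted contractions of curves *)

Section Contraction.
Variable X : NormedSpace.
Hypothesis HX : complete X.
Variables (Rel : (R -> X) -> (R -> X) -> Prop) (w : R -> R) (q D0 : R) (u0 : R -> X).
Let cont (u : R -> X) := forall t, curve_cont_at u t.
Hypothesis Hq : 0 <= q < 1.
Hypothesis Hw : forall t, 0 <= w t.
Hypothesis Hwloc : forall t, exists M d, 0 < d /\ forall s, Rabs (s - t) < d -> w s <= M.
Hypothesis Hex : forall u, cont u -> exists v, cont v /\ Rel u v.
Hypothesis Hlip : forall D u1 u2 v1 v2, 0 <= D -> cont u1 -> cont u2 -> Rel u1 v1 -> Rel u2 v2 ->
  (forall t, ⟦u1 t ⊖ u2 t⟧ <= D * w t) -> forall t, ⟦v1 t ⊖ v2 t⟧ <= q * D * w t.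
Hypothesis Hu0 : cont u0.
Hypothesis HD0 : 0 <= D0.
Hypothesis Hstart : forall v, Rel u0 v -> forall t, ⟦v t ⊖ u0 t⟧ <= D0 * w t.

(** Banach's principle for the distance [sup |u - v| / w], which may be infinite; [Hstart] puts the
    first iterate at finite distance. A relation replaces the map because images exist only for
    continuous curves; [Hlip] with [D = 0] makes it single-valued. *)
Lemma weighted_fixed_point : exists u, cont u /\ Rel u u.
Proof.
  destruct (functional_choice (fun u v => cont u -> cont v /\ Rel u v)) as [Phi HPhi].
  { intros u. destruct (classic (cont u)) as [C|C].
    - destruct (Hex u C) as [v Hv]. now exists v.
    - exists u; easy. }
  set (u := fix u n := match n with O => u0 | S n => Phi (u n) end).
  assert (Cu : forall n, cont (u n)).
  { induction n; [exact Hu0|]. exact (proj1 (HPhi (u n) IHn)). }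
  assert (Ru : forall n, Rel (u n) (u (S n))) by (intros n; exact (proj2 (HPhi (u n) (Cu n)))).
  assert (Hstep : forall n t, ⟦u (S n) t ⊖ u n t⟧ <= D0 * q ^ n * w t).
  { induction n; intros t.
    - simpl. rewrite Rmult_1_r. apply Hstart, (Ru 0%nat).
    - eapply Rle_trans; [apply (Hlip (D0 * q ^ n) (u (S n)) (u n)); auto|].
      + apply Rmult_le_pos; auto. now apply pow_le.
      + simpl. right; ring. }
  (* Sum of the geometric series of the steps. *)
  set (B := D0 / (1 - q)).
  assert (HB : 0 <= B) by (apply Rdiv_le_0_compat; lra).
  assert (Hdist : forall n m t, ⟦u (n + m)%nat t ⊖ u n t⟧ <= B * q ^ n * (1 - q ^ m) * w t).
  { intros n; induction m; intros t.
    - rewrite Nat.add_0_r, norm_sub_diag. simpl. right; ring.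
    - rewrite Nat.add_succ_r. eapply Rle_trans; [apply (norm_triangle X (u (n + m)%nat t))|].
      eapply Rle_trans; [apply Rplus_le_compat; [apply Hstep|apply IHm]|].
      right. rewrite pow_add. simpl. unfold B. field. lra. }
  clearbody B.
  assert (Hdist' : forall n m t, (n <= m)%nat -> ⟦u m t ⊖ u n t⟧ <= B * q ^ n * w t).
  { intros n m t Hnm. replace m with (n + (m - n))%nat by lia.
    eapply Rle_trans; [apply Hdist|].
    assert (0 <= q ^ n) by (apply pow_le; lra). assert (0 <= q ^ (m - n)) by (apply pow_le; lra).
    specialize (Hw t).
    assert (0 <= B * q ^ n * w t) by (repeat apply Rmult_le_pos; auto). nra. }
  assert (Hsmall : forall c e, 0 <= c -> 0 < e -> exists n, B * q ^ n * c < e).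
  { intros c e Hc He. destruct (pow_lt_1_zero q ltac:(rewrite Rabs_right; lra) (e / (B * c + 1)))
      as [N HN].
    { apply Rdiv_lt_0_compat; [lra|]. assert (0 <= B * c) by now apply Rmult_le_pos. lra. }
    exists N. specialize (HN N (Nat.le_refl _)). rewrite Rabs_right in HN by (apply Rle_ge, pow_le; lra).
    assert (0 <= B * c) by now apply Rmult_le_pos. assert (0 <= q ^ N) by (apply pow_le; lra).
    apply (Rmult_lt_compat_r (B * c + 1)) in HN; [|lra].
    unfold Rdiv in HN. rewrite Rmult_assoc, Rinv_l in HN by lra. nra. }
  destruct (functional_choice (fun t l => forall e, 0 < e -> exists N, forall n, (N <= n)%nat ->
     ⟦u n t ⊖ l⟧ < e)) as [v Hv].
  { intros t. apply HX. intros e He. destruct (Hsmall (w t) (e / 2)) as [N HN]; [auto|lra|].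
    exists N. intros m n Hm Hn.
    eapply Rle_lt_trans; [apply (norm_triangle X (u N t))|].
    rewrite (norm_subC X (u N t)).
    generalize (Hdist' N m t Hm) (Hdist' N n t Hn). lra. }
  assert (Hvn : forall n t, ⟦u n t ⊖ v t⟧ <= B * q ^ n * w t).
  { intros n t. apply le_of_le_eps with 1; [lra|]. intros e He.
    destruct (Hv t e He) as [N HN]. specialize (HN (N + n)%nat ltac:(lia)).
    eapply Rle_trans; [apply (norm_triangle X (u (N + n)%nat t))|].
    rewrite (norm_subC X (u n t)). generalize (Hdist' n (N + n)%nat t ltac:(lia)). lra. }
  assert (Cv : cont v).
  (* Local boundedness of [w] makes the convergence locally uniform, so continuity passes to the
     limit. *)
  { intros t e He. destruct (Hwloc t) as [M [d1 [Hd1 HM]]].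
    destruct (Hsmall (Rabs M) (e / 4) (Rabs_pos M)) as [n Hn]; [lra|].
    destruct (Cu n t (e / 4) ltac:(lra)) as [d2 [Hd2 D2]].
    exists (Rmin d1 d2). split; [now apply Rmin_glb_lt|]. intros s Hs.
    specialize (D2 s (Rlt_le_trans _ _ _ Hs (Rmin_r _ _))).
    assert (Hb : forall s, Rabs (s - t) < d1 -> ⟦u n s ⊖ v s⟧ < e / 4).
    { intros r Hr. eapply Rle_lt_trans; [apply Hvn|]. apply Rle_lt_trans with (2 := Hn).
      apply Rmult_le_compat_l.
      - apply Rmult_le_pos; auto. apply pow_le; lra.
      - apply Rle_trans with (1 := HM r Hr). apply Rle_abs. }
    assert (H1 := Hb s (Rlt_le_trans _ _ _ Hs (Rmin_l _ _))).
    assert (H2 := Hb t ltac:(rewrite Rminus_diag, Rabs_R0; lra)).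
    eapply Rle_lt_trans; [apply (norm_triangle X (u n s))|].
    generalize (norm_triangle X (u n t) (u n s) (v t)). rewrite (norm_subC X (v s)). lra. }
  exists v. split; auto.
  (* The image [v'] of the limit is itself the limit of the shifted sequence [u (S n)], hence equals
     [v]. *)
  destruct (Hex v Cv) as [v' [Cv' Rv]].
  replace v with v' at 2; auto. extensionality t.
  apply norm_sub_eq0. apply Rle_antisym; [|apply norm_ge0].
  apply le_of_le_eps with 1; [lra|]. intros e He.
  destruct (Hsmall (w t) (e / 2)) as [n Hn]; [auto|lra|].
  assert (0 <= q ^ n) by (apply pow_le; lra).
  assert (0 <= B * q ^ n) by now apply Rmult_le_pos.
  assert (H1 := Hlip (B * q ^ n) (u n) v (u (S n)) v' H0 (Cu n) Cv (Ru n) Rv (Hvn n) t).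
  assert (H2 := Hvn (S n) t). simpl in H1, H2.
  assert (H3 := norm_triangle X (Phi (u n) t) (v' t) (v t)).
  rewrite (norm_subC X (v' t) (Phi (u n) t)) in H3.
  assert (H4 : 0 <= B * q ^ n * w t) by now apply Rmult_le_pos.
  replace (q * (B * q ^ n) * w t) with (q * (B * q ^ n * w t)) in H1 by ring.
  replace (B * (q * q ^ n) * w t) with (q * (B * q ^ n * w t)) in H2 by ring.
  assert (q * (B * q ^ n * w t) <= 1 * (B * q ^ n * w t)) by (apply Rmult_le_compat_r; lra).
  lra.
Qed.

End Contraction.

(** * The linear equation and its evolution operator *)

(** Minimality of the bound is what makes it vary continuously with the operator, so that the norm
    of [A t] has a primitive to feed Gronwall's inequality. *)
Lemma operator_norm (X : NormedSpace) (L : X -> X) : bounded_linear L ->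
  exists N, 0 <= N /\ (forall x, ⟦L x⟧ <= N * ⟦x⟧) /\
    forall C, 0 <= C -> (forall x, ⟦L x⟧ <= C * ⟦x⟧) -> N <= C.
Proof.
  intros [LA [LS [C LC]]].
  assert (L0 : ⟦L 0v⟧ = 0).
  { rewrite <- (ns_scal0 X 0v), LS, ns_scal0. apply norm_zero. }
  destruct (completeness (fun r => exists x, ⟦x⟧ <= 1 /\ r = ⟦L x⟧)) as [N [Hub Hlub]].
  { exists (Rabs C). intros r [x [Hx ->]]. apply Rle_trans with (1 := LC x).
    pose proof (norm_ge0 X x). pose proof (Rle_abs C). pose proof (Rabs_pos C). nra. }
  { exists 0, 0v. rewrite norm_zero; split; [lra|auto]. }
  assert (HN : 0 <= N).
  { apply Hub. exists 0v. rewrite norm_zero; split; [lra|auto]. }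
  exists N. split; [auto|split].
  - intros x. pose proof (norm_ge0 X x) as Hx.
    destruct (Req_dec ⟦x⟧ 0) as [E|E].
    + apply ns_norm_eq0 in E. subst. rewrite L0, norm_zero; lra.
    + assert (H : ⟦L (/ ⟦x⟧ ⊙ x)⟧ <= N).
      { apply Hub. exists (/ ⟦x⟧ ⊙ x). split; auto.
        rewrite ns_normZ, Rabs_right by (left; apply Rinv_0_lt_compat; lra).
        right; now field. }
      rewrite LS, ns_normZ, Rabs_right in H by (left; apply Rinv_0_lt_compat; lra).
      apply (Rmult_le_compat_r ⟦x⟧) in H; auto.
      replace (/ ⟦x⟧ * ⟦L x⟧ * ⟦x⟧) with ⟦L x⟧ in H by now field. exact H.
  - intros C' HC' H. apply Hlub. intros r [x [Hx ->]].
    apply Rle_trans with (1 := H x). pose proof (norm_ge0 X x). nra.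
Qed.

Lemma operator_norm_primitive (X : NormedSpace) (A : R -> X -> X) :
  (forall t, bounded_linear (A t)) -> op_continuous A ->
  exists N C : R -> R, (forall t, derivable_pt_lim C t (N t)) /\
    forall t, 0 <= N t /\ forall x, ⟦A t x⟧ <= N t * ⟦x⟧.
Proof.
  intros HA HAc.
  destruct (functional_choice _ (fun t => operator_norm X (A t) (HA t))) as [N HN].
  assert (Hdiff : forall e s t, (forall x, ⟦A s x ⊖ A t x⟧ <= e * ⟦x⟧) -> 0 <= e -> N s <= N t + e).
  { intros e s t He H. destruct (HN s) as [_ [_ Hs]]. destruct (HN t) as [H0 [Ht _]].
    apply Hs; [lra|]. intros x. eapply Rle_trans; [apply (norm_le_sub X _ (A t x))|].
    specialize (Ht x). specialize (He x). lra. }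
  assert (Nc : forall t, continuity_pt N t).
  { intros t e He. destruct (HAc t (e / 2) ltac:(lra)) as [d [Hd D]].
    exists d; split; auto. intros s [_ Hs]. simpl in *. unfold R_dist, Rdist in *.
    specialize (D s Hs).
    assert (H1 := Hdiff (e / 2) s t D ltac:(lra)).
    assert (H2 := Hdiff (e / 2) t s). apply Rabs_def1; [lra|].
    assert (N t <= N s + e / 2); [|lra]. apply H2; [|lra]. intros x. now rewrite norm_subC. }
  destruct (real_primitive N Nc) as [C HC].
  exists N, C. split; auto. intros t. destruct (HN t) as [H0 [Ht _]]. auto.
Qed.

Lemma derivable_lim_cont (C : R -> R) t l : derivable_pt_lim C t l ->
  forall e, 0 < e -> exists d, 0 < d /\ forall s, Rabs (s - t) < d -> Rabs (C s - C t) < e.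
Proof.
  intros D e He.
  assert (Cc : continuity_pt C t) by (apply derivable_continuous_pt; now exists l).
  destruct (Cc e He) as [d [Hd H]]. exists d; split; auto. intros s Hs.
  destruct (Req_dec s t) as [->|Hst]; [rewrite Rminus_diag, Rabs_R0; lra|].
  apply H. split; [split; [exact I|auto]|exact Hs].
Qed.

Lemma exp_abs_loc_bounded (C : R -> R) r t l : derivable_pt_lim C t l ->
  exists M d, 0 < M /\ 0 < d /\ forall s, Rabs (s - t) < d -> exp (Rabs (C s - C r)) <= M.
Proof.
  intros D. destruct (derivable_lim_cont C t l D 1 Rlt_0_1) as [d [Hd H]].
  exists (exp (Rabs (C t - C r) + 1)), d. split; [apply exp_pos|split; auto].
  intros s Hs. left. apply exp_increasing. specialize (H s Hs).
  replace (C s - C r) with ((C s - C t) + (C t - C r)) by ring.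
  generalize (Rabs_triang (C s - C t) (C t - C r)). lra.
Qed.

Section Linear.
Variable X : NormedSpace.
Hypothesis HX : complete X.
Variables (A : R -> X -> X) (T : R -> R -> X -> X).
Hypothesis HA : forall t, bounded_linear (A t).
Hypothesis HT : evolution_operator A T.
Variables (N C : R -> R).
Hypothesis HC : forall t, derivable_pt_lim C t (N t).
Hypothesis HN : forall t, 0 <= N t /\ forall x, ⟦A t x⟧ <= N t * ⟦x⟧.

Lemma evol_id s v : T s s v = v.
Proof. apply HT. Qed.

Lemma evol_sol s v t : has_deriv (fun t => T t s v) t (A t (T t s v)).
Proof. apply HT. Qed.

Lemma evol_unique x : is_solution A x -> forall t s, T t s (x s) = x t.
Proof. apply HT. Qed.

Lemma evol_comp t s r v : T t s (T s r v) = T t r v.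
Proof. apply (evol_unique (fun t => T t r v)). intros u. apply evol_sol. Qed.

Lemma evol_inv t s v : T t s (T s t v) = v.
Proof. now rewrite evol_comp, evol_id. Qed.

Lemma bounded_linear_scal c : bounded_linear (fun u : X => c ⊙ u).
Proof.
  repeat split; intros; try vec. exists (Rabs c). intros u. rewrite ns_normZ; lra.
Qed.

Lemma evol_bound t s v : ⟦T t s v⟧ <= exp (Rabs (C t - C s)) * ⟦v⟧.
Proof.
  rewrite <- (evol_id s v) at 2.
  apply (gronwall_abs X (fun t => T t s v) (fun t => A t (T t s v)) C N); auto.
  - intros; apply evol_sol.
  - intros; apply HN.
  - intros; apply HN.
Qed.

(** Linearity comes from uniqueness: a combination of solutions solves the equation and has the
    right value at time [s]. *)
Lemma evol_linear t s : bounded_linear (T t s).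
Proof.
  split; [|split].
  - intros u v. symmetry.
    rewrite <- (evol_unique (fun t => T t s u ⊕ T t s v)) with (s := s).
    + now rewrite !evol_id.
    + intros r. rewrite (proj1 (HA r)). apply has_deriv_add; apply evol_sol.
  - intros c u. symmetry.
    rewrite <- (evol_unique (fun t => c ⊙ T t s u)) with (s := s).
    + now rewrite !evol_id.
    + intros r. rewrite (proj1 (proj2 (HA r))).
      apply (has_deriv_lin X (fun u => c ⊙ u)); [apply bounded_linear_scal|apply evol_sol].
  - exists (exp (Rabs (C t - C s))). intros; apply evol_bound.
Qed.

Lemma linear_sub (L : X -> X) u v : bounded_linear L -> L (u ⊖ v) = L u ⊖ L v.
Proof. intros [LA [LS _]]. unfold ns_sub. now rewrite LA, !ns_oppE, LS. Qed.

Lemma evol_sub t s u v : T t s (u ⊖ v) = T t s u ⊖ T t s v.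
Proof. apply linear_sub, evol_linear. Qed.

Lemma evol_add t s u v : T t s (u ⊕ v) = T t s u ⊕ T t s v.
Proof. apply evol_linear. Qed.

(** Continuity in the second argument of [T] comes from the cocycle property: the difference is
    [T r s] applied to [g s ⊖ T s t (g t)], where [T r s] is bounded locally uniformly in [s] and
    the argument is small. *)
Lemma evol_pullback_cont r g : (forall t, curve_cont_at g t) ->
  forall t, curve_cont_at (fun s => T r s (g s)) t.
Proof.
  intros Cg t e He.
  destruct (exp_abs_loc_bounded C r t _ (HC t)) as [M [d0 [HM [Hd0 HMb]]]].
  assert (He' : 0 < e / (2 * M)) by (apply Rdiv_lt_0_compat; lra).
  destruct (Cg t _ He') as [d1 [Hd1 D1]].
  destruct (has_deriv_cont X _ t _ (evol_sol t (g t) t) _ He') as [d2 [Hd2 D2]].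
  exists (Rmin d0 (Rmin d1 d2)). split; [repeat apply Rmin_glb_lt; auto|].
  intros s Hs. assert (Hs0 := Rlt_le_trans _ _ _ Hs (Rmin_l _ _)).
  assert (Hs' := Rlt_le_trans _ _ _ Hs (Rmin_r _ _)).
  specialize (D1 s (Rlt_le_trans _ _ _ Hs' (Rmin_l _ _))).
  specialize (D2 s (Rlt_le_trans _ _ _ Hs' (Rmin_r _ _))).
  rewrite evol_id in D2.
  replace (T r s (g s) ⊖ T r t (g t)) with (T r s (g s ⊖ T s t (g t)))
    by now rewrite evol_sub, evol_comp.
  eapply Rle_lt_trans; [apply evol_bound|].
  rewrite Rabs_minus_sym.
  assert (H1 := norm_triangle X (g t) (g s) (T s t (g t))).
  rewrite (norm_subC X (g t)) in H1.
  apply Rle_lt_trans with (M * ⟦g s ⊖ T s t (g t)⟧).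
  { apply Rmult_le_compat_r; [apply norm_ge0|auto]. }
  apply Rlt_le_trans with (M * (e / (2 * M) + e / (2 * M))).
  { apply Rmult_lt_compat_l; lra. }
  right; field; lra.
Qed.

(** Product rule for an operator known to be differentiable only on fixed vectors; the local bound
    on [T] absorbs the remainder of [y]. *)
Lemma evol_product r y t v : has_deriv y t v ->
  has_deriv (fun t => T t r (y t)) t (A t (T t r (y t)) ⊕ T t r v).
Proof.
  intros Dy e He.
  destruct (exp_abs_loc_bounded C r t _ (HC t)) as [M [d0 [HM [Hd0 HMb]]]].
  destruct (Dy (e / (3 * M))) as [d1 [Hd1 D1]]; [apply Rdiv_lt_0_compat; lra|].
  destruct (evol_sol r (y t) t (e / 3)) as [d2 [Hd2 D2]]; [lra|].
  destruct (has_deriv_cont X _ t _ (evol_sol r v t) (e / 3)) as [d3 [Hd3 D3]]; [lra|].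
  exists (Rmin (Rmin d0 d1) (Rmin d2 d3)). split; [repeat apply Rmin_glb_lt; auto|].
  intros h Hh Hhd.
  pose proof (Rmin_l (Rmin d0 d1) (Rmin d2 d3)). pose proof (Rmin_r (Rmin d0 d1) (Rmin d2 d3)).
  pose proof (Rmin_l d0 d1). pose proof (Rmin_r d0 d1).
  pose proof (Rmin_l d2 d3). pose proof (Rmin_r d2 d3).
  specialize (D1 h Hh ltac:(lra)). specialize (D2 h Hh ltac:(lra)).
  assert (Eh : t + h - t = h) by ring.
  specialize (D3 (t + h) ltac:(rewrite Eh; lra)).
  specialize (HMb (t + h) ltac:(rewrite Eh; lra)).
  set (z := y (t + h) ⊖ y t ⊖ h ⊙ v) in *.
  assert (Ez : y (t + h) = z ⊕ y t ⊕ h ⊙ v) by (unfold z; vec).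
  (* The three terms are the remainder of [y] transported by [T], the remainder of [T] on the fixed
     vector [y t], and the variation of [T] on [v], multiplied by [h]. *)
  replace (T (t + h) r (y (t + h)) ⊖ T t r (y t) ⊖ h ⊙ (A t (T t r (y t)) ⊕ T t r v)) with
    (T (t + h) r z ⊕ (T (t + h) r (y t) ⊖ T t r (y t) ⊖ h ⊙ A t (T t r (y t)))
      ⊕ h ⊙ (T (t + h) r v ⊖ T t r v)).
  2:{ rewrite Ez, !evol_add, (proj1 (proj2 (evol_linear (t + h) r)) h v). vec. }
  eapply Rle_trans; [apply ns_normD|].
  eapply Rle_trans; [apply Rplus_le_compat_r, ns_normD|].
  rewrite ns_normZ.
  assert (Hp : 0 < Rabs h) by now apply Rabs_pos_lt.
  assert (Hz : ⟦T (t + h) r z⟧ <= e / 3 * Rabs h).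
  { eapply Rle_trans; [apply evol_bound|].
    apply Rle_trans with (M * (e / (3 * M) * Rabs h)).
    - apply Rmult_le_compat; auto; [left; apply exp_pos|apply norm_ge0].
    - right; field; lra. }
  nra.
Qed.

(** Variation of constants, without differentiating [T 0 t] in [t]: for a primitive [W] of the
    pulled back forcing, [x - T(t,0) W] solves the linear equation, so its pullback to time 0 is
    constant. *)
Lemma forced_pullback x g : (forall t, curve_cont_at g t) ->
  (forall t, has_deriv x t (A t (x t) ⊕ g t)) ->
  forall t, has_deriv (fun t => T 0 t (x t)) t (T 0 t (g t)).
Proof.
  intros Cg Dx.
  destruct (curve_primitive X HX _ (evol_pullback_cont 0 g Cg)) as [W HW].
  set (d := fun t => x t ⊖ T t 0 (W t)).
  assert (Sd : is_solution A d).
  { intros t. unfold d. rewrite (linear_sub (A t)) by auto.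
    replace (A t (x t) ⊖ A t (T t 0 (W t))) with
      ((A t (x t) ⊕ g t) ⊖ (A t (T t 0 (W t)) ⊕ T t 0 (T 0 t (g t)))).
    - apply has_deriv_sub; auto. apply evol_product, HW.
    - rewrite evol_inv. vec. }
  intros t. replace (fun t => T 0 t (x t)) with (fun t => W t ⊕ d 0).
  - replace (T 0 t (g t)) with (T 0 t (g t) ⊕ 0v) by vec.
    apply has_deriv_add; [apply HW|apply has_deriv_const].
  - extensionality s. rewrite <- (evol_unique d Sd 0 s). unfold d.
    rewrite evol_sub, evol_inv. vec.
Qed.

Lemma forced_pushforward y g : (forall t, has_deriv y t (T 0 t (g t))) ->
  forall t, has_deriv (fun t => T t 0 (y t)) t (A t (T t 0 (y t)) ⊕ g t).
Proof.
  intros Dy t. rewrite <- (evol_inv t 0 (g t)) at 1. now apply evol_product.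
Qed.

End Linear.

(** * The initial value problem for the perturbed equation *)

Lemma nonneg_deriv_incr (g dg : R -> R) : (forall t, derivable_pt_lim g t (dg t)) ->
  (forall t, 0 <= dg t) -> forall s t, s <= t -> g s <= g t.
Proof.
  intros Dg Hp s t Hst. destruct (Req_dec s t) as [->|Hne]; [lra|].
  destruct (MVT_cor2 g dg s t) as [c [E _]]; [lra|intros; apply Dg|].
  specialize (Hp c). nra.
Qed.

(** To the right of [tau] the majorant is the derivative of [D/2 exp(2 (g - g tau))]; integrating
    divides by the exponent 2, which is the source of the contraction factor of the Picard
    iteration. *)
Lemma exp_deriv_bound (X : NormedSpace) (z dz : R -> X) (g dg : R -> R) D tau t : tau <= t ->
  (forall t, has_deriv z t (dz t)) -> (forall t, derivable_pt_lim g t (dg t)) ->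
  (forall t, 0 <= dg t) -> 0 <= D ->
  (forall t, ⟦dz t⟧ <= D * dg t * exp (2 * Rabs (g t - g tau))) ->
  ⟦z t ⊖ z tau⟧ <= D / 2 * exp (2 * Rabs (g t - g tau)).
Proof.
  intros Ht Dz Dg Hp HD Hd.
  assert (Hab : forall s, tau <= s -> Rabs (g s - g tau) = g s - g tau).
  { intros s Hs. apply Rabs_right. generalize (nonneg_deriv_incr g dg Dg Hp tau s Hs). lra. }
  apply Rle_trans with
    (D / 2 * exp (2 * (g t - g tau)) - D / 2 * exp (2 * (g tau - g tau))).
  - apply (mean_value_ineq X z dz (fun s => D / 2 * exp (2 * (g s - g tau)))
      (fun s => D * dg s * exp (2 * (g s - g tau)))); auto.
    + intros s _. apply is_derive_Reals. assert (Ds := Dg s). apply is_derive_Reals in Ds.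
      evar_last. apply (is_derive_scal (fun s => exp (2 * (g s - g tau))) s (D / 2)).
      apply (is_derive_comp exp (fun s => 2 * (g s - g tau))). apply is_derive_exp.
      apply (is_derive_scal (fun s => g s - g tau) s 2).
      apply (is_derive_minus g (fun _ => g tau)); [exact Ds|apply is_derive_const].
      unfold plus, minus, opp, plus, zero, scal; simpl. unfold mult; simpl. field.
    + intros s Hs. rewrite <- (Hab s) by lra. apply Hd.
  - rewrite Hab by auto. assert (0 < exp (2 * (g tau - g tau))) by apply exp_pos. nra.
Qed.

Lemma exp_deriv_bound_abs (X : NormedSpace) (z dz : R -> X) (g dg : R -> R) D tau t :
  (forall t, has_deriv z t (dz t)) -> (forall t, derivable_pt_lim g t (dg t)) ->
  (forall t, 0 <= dg t) -> 0 <= D ->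
  (forall t, ⟦dz t⟧ <= D * dg t * exp (2 * Rabs (g t - g tau))) ->
  ⟦z t ⊖ z tau⟧ <= D / 2 * exp (2 * Rabs (g t - g tau)).
Proof.
  intros Dz Dg Hp HD Hd. destruct (Rle_dec tau t) as [Ht|Ht].
  { now apply (exp_deriv_bound X z dz g dg). }
  assert (E := exp_deriv_bound X (fun s => z (- s)) (fun s => ns_opp (dz (- s)))
    (fun s => - g (- s)) (fun s => dg (- s)) D (- tau) (- t)).
  cbv beta in E. rewrite !Ropp_involutive in E.
  assert (Hab : forall u v, Rabs (- u - - v) = Rabs (u - v)).
  { intros u v. rewrite <- Rabs_Ropp. f_equal; ring. }
  rewrite Hab in E. apply E; auto; [lra| | |].
  - intros r. apply has_deriv_rev, Dz.
  - intros r. apply derivable_rev, Dg.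
  - intros r. rewrite norm_opp, Hab. apply Hd.
Qed.

Definition perturbed {X : NormedSpace} (A f : R -> X -> X) (t : R) (x : X) : X := A t x ⊕ f t x.

Section Perturbed.
Variable X : NormedSpace.
Hypothesis HX : complete X.
Variables (A f : R -> X -> X) (N C l dl m : R -> R) (alpha gamma : R).
Hypothesis HA : forall t, bounded_linear (A t).
Hypothesis HAc : op_continuous A.
Hypothesis HC : forall t, derivable_pt_lim C t (N t).
Hypothesis HN : forall t, 0 <= N t /\ forall x, ⟦A t x⟧ <= N t * ⟦x⟧.
Hypothesis Hl : forall t, derivable_pt_lim l t (dl t).
Hypothesis Hm : forall t, 0 <= m t <= dl t.
Hypothesis Ha : 0 < alpha.
Hypothesis Hg : 0 < gamma.
Hypothesis Hfc : jointly_continuous f.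
Hypothesis Hfb : forall t x, ⟦f t x⟧ <= alpha * m t.
Hypothesis Hfl : forall t x1 x2, ⟦f t x1 ⊖ f t x2⟧ <= gamma * m t * ⟦x1 ⊖ x2⟧.

(** The bound [m] on [f] comes without a primitive; it is majorised by [dl], which has the primitive
    [l]. *)
Definition lip_primitive t := C t + gamma * l t.
Definition lip_rate t := N t + gamma * dl t.

Lemma lip_primitive_deriv t : derivable_pt_lim lip_primitive t (lip_rate t).
Proof.
  apply is_derive_Reals. assert (D1 := HC t). assert (D2 := Hl t).
  apply is_derive_Reals in D1. apply is_derive_Reals in D2.
  apply (is_derive_plus C (fun t => gamma * l t)); auto.
  now apply (is_derive_scal l t gamma).
Qed.

Lemma lip_rate_ge0 t : 0 <= lip_rate t.
Proof. unfold lip_rate. generalize (HN t) (Hm t). intros [H1 _] H2. nra. Qed.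

Lemma operator_jointly_continuous : jointly_continuous A.
Proof.
  intros t x e He. destruct (HN t) as [Hn Hnt].
  set (e1 := Rmin 1 (e / (2 * (⟦x⟧ + 1)))).
  pose proof (norm_ge0 X x) as Hx.
  assert (He1 : 0 < e1) by (apply Rmin_glb_lt; [lra|apply Rdiv_lt_0_compat; lra]).
  destruct (HAc t e1 He1) as [d [Hd D]].
  exists (Rmin d (e / (2 * (N t + 1)))). split.
  { apply Rmin_glb_lt; auto. apply Rdiv_lt_0_compat; lra. }
  intros s y Hs Hy.
  assert (D' := D s (Rlt_le_trans _ _ _ Hs (Rmin_l _ _))).
  assert (Hy' := Rlt_le_trans _ _ _ Hy (Rmin_r _ _)).
  eapply Rle_lt_trans; [apply (norm_triangle X (A s x))|].
  rewrite <- (linear_sub X (A s)) by auto.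
  assert (H1 : ⟦A s (y ⊖ x)⟧ <= (N t + 1) * ⟦y ⊖ x⟧).
  { eapply Rle_trans; [apply (norm_le_sub X _ (A t (y ⊖ x)))|].
    generalize (Hnt (y ⊖ x)) (D' (y ⊖ x)) (Rmin_l 1 (e / (2 * (⟦x⟧ + 1)))) (norm_ge0 X (y ⊖ x)).
    fold e1. intros. nra. }
  assert (H2 : ⟦A s x ⊖ A t x⟧ <= e / 2).
  { eapply Rle_trans; [apply D'|].
    apply Rle_trans with (e / (2 * (⟦x⟧ + 1)) * ⟦x⟧); [apply Rmult_le_compat_r; auto; apply Rmin_r|].
    apply Rle_trans with (e / (2 * (⟦x⟧ + 1)) * (⟦x⟧ + 1)); [|right; field; lra].
    apply Rmult_le_compat_l; [|lra]. left; apply Rdiv_lt_0_compat; lra. }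
  apply (Rmult_lt_compat_l (N t + 1)) in Hy'; [|lra].
  replace ((N t + 1) * (e / (2 * (N t + 1)))) with (e / 2) in Hy' by (field; lra). lra.
Qed.

Lemma field_cont u : (forall t, curve_cont_at u t) -> forall t, curve_cont_at (fun t => perturbed A f t (u t)) t.
Proof.
  intros Cu t. apply curve_cont_add; apply curve_cont_joint; auto.
  apply operator_jointly_continuous.
Qed.

Lemma field_lip t x y : ⟦perturbed A f t x ⊖ perturbed A f t y⟧ <= lip_rate t * ⟦x ⊖ y⟧.
Proof.
  unfold perturbed. replace (A t x ⊕ f t x ⊖ (A t y ⊕ f t y)) with
    ((A t x ⊖ A t y) ⊕ (f t x ⊖ f t y)) by vec.
  eapply Rle_trans; [apply ns_normD|]. rewrite <- (linear_sub X (A t)) by auto.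
  destruct (HN t) as [_ Hnt]. specialize (Hnt (x ⊖ y)). specialize (Hfl t x y).
  unfold lip_rate. pose proof (norm_ge0 X (x ⊖ y)). specialize (Hm t).
  assert (gamma * m t * ⟦x ⊖ y⟧ <= gamma * dl t * ⟦x ⊖ y⟧).
  { apply Rmult_le_compat_r; auto. apply Rmult_le_compat_l; lra. }
  lra.
Qed.

Lemma perturbed_gronwall x y : is_solution (perturbed A f) x -> is_solution (perturbed A f) y ->
  forall s t, ⟦x t ⊖ y t⟧ <= exp (Rabs (lip_primitive t - lip_primitive s)) * ⟦x s ⊖ y s⟧.
Proof.
  intros Sx Sy s t.
  apply (gronwall_abs X (fun t => x t ⊖ y t) (fun t => perturbed A f t (x t) ⊖ perturbed A f t (y t))
    lip_primitive lip_rate).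
  - intros r. now apply has_deriv_sub.
  - apply lip_primitive_deriv.
  - apply lip_rate_ge0.
  - intros r. apply field_lip.
Qed.

Lemma perturbed_unique x y s : is_solution (perturbed A f) x -> is_solution (perturbed A f) y -> x s = y s ->
  forall t, x t = y t.
Proof.
  intros Sx Sy E t. apply norm_sub_eq0. apply Rle_antisym; [|apply norm_ge0].
  eapply Rle_trans; [now apply (perturbed_gronwall x y Sx Sy s t)|].
  rewrite E, norm_sub_diag. lra.
Qed.

(* Picard iteration contracts by 1/2 for the weight [exp (2 |g - g tau|)], [g] a primitive of the Lipschitz rate *)
Lemma perturbed_ivp tau xi : exists x, is_solution (perturbed A f) x /\ x tau = xi.
Proof.
  set (w := fun t => exp (2 * Rabs (lip_primitive t - lip_primitive tau))).
  (* Chosen so that the field along the constant curve [xi], at most [N |xi| + alpha dl], is below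
     [D0 (N + gamma dl)]. *)
  set (D0 := ⟦xi⟧ + alpha / gamma).
  assert (HD0 : 0 < D0).
  { unfold D0. pose proof (norm_ge0 X xi). assert (0 < alpha / gamma) by now apply Rdiv_lt_0_compat. lra. }
  destruct (weighted_fixed_point X HX
    (fun u v => v tau = xi /\ forall t, has_deriv v t (perturbed A f t (u t))) w (1 / 2) (D0 / 2)
    (fun _ => xi)) as [x [Cx [E Sx]]].
  - lra.
  - intros t. left; apply exp_pos.
  - intros t. destruct (derivable_lim_cont _ t _ (lip_primitive_deriv t) 1 Rlt_0_1) as [d [Hd H]].
    exists (exp (2 * (Rabs (lip_primitive t - lip_primitive tau) + 1))), d. split; auto.
    intros s Hs. left. apply exp_increasing. specialize (H s Hs).
    generalize (Rabs_triang (lip_primitive s - lip_primitive t) (lip_primitive t - lip_primitive tau)).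
    replace (lip_primitive s - lip_primitive t + (lip_primitive t - lip_primitive tau))
      with (lip_primitive s - lip_primitive tau) by ring. lra.
  - intros u Cu. destruct (curve_primitive X HX _ (field_cont u Cu)) as [G HG].
    assert (D : forall t, has_deriv (fun t => G t ⊖ (G tau ⊖ xi)) t (perturbed A f t (u t))).
    { intros t. apply has_deriv_subr, HG. }
    exists (fun t => G t ⊖ (G tau ⊖ xi)). split; [|split; [vec|exact D]].
    intros t. eapply has_deriv_cont, D.
  - intros D u1 u2 v1 v2 HD _ _ [E1 S1] [E2 S2] Hu t.
    replace (v1 t ⊖ v2 t) with ((v1 t ⊖ v2 t) ⊖ (v1 tau ⊖ v2 tau)) by (rewrite E1, E2; vec).
    apply Rle_trans with (D / 2 * w t); [|right; field].
    apply (exp_deriv_bound_abs X (fun t => v1 t ⊖ v2 t)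
      (fun t => perturbed A f t (u1 t) ⊖ perturbed A f t (u2 t)) lip_primitive lip_rate); auto.
    + intros r. now apply has_deriv_sub.
    + apply lip_primitive_deriv.
    + apply lip_rate_ge0.
    + intros r. eapply Rle_trans; [apply field_lip|].
      replace (D * lip_rate r * exp (2 * Rabs (lip_primitive r - lip_primitive tau)))
        with (lip_rate r * (D * w r)) by (unfold w; ring).
      apply Rmult_le_compat_l; auto. apply lip_rate_ge0.
  - intros t e He. exists 1; split; [lra|]. intros. now rewrite norm_sub_diag.
  - lra.
  - intros v [E Sv] t. rewrite <- E.
    apply (exp_deriv_bound_abs X v (fun t => perturbed A f t xi) lip_primitive lip_rate); auto.
    + apply lip_primitive_deriv.
    + apply lip_rate_ge0.
    + lra.
    + intros r. unfold perturbed. eapply Rle_trans; [apply ns_normD|].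
      apply Rle_trans with (D0 * lip_rate r * 1).
      * rewrite Rmult_1_r. destruct (HN r) as [Hn Hnr]. specialize (Hnr xi). specialize (Hfb r xi).
        specialize (Hm r). pose proof (norm_ge0 X xi) as Hx. unfold D0, lip_rate.
        assert (H1 : 0 <= alpha / gamma) by (left; now apply Rdiv_lt_0_compat).
        replace ((⟦xi⟧ + alpha / gamma) * (N r + gamma * dl r)) with
          (N r * ⟦xi⟧ + alpha / gamma * N r + ⟦xi⟧ * (gamma * dl r) + alpha * dl r)
          by (field; lra).
        assert (0 <= alpha / gamma * N r) by now apply Rmult_le_pos.
        assert (0 <= ⟦xi⟧ * (gamma * dl r)) by (repeat apply Rmult_le_pos; lra).
        assert (alpha * m r <= alpha * dl r) by (apply Rmult_le_compat_l; lra).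
        lra.
      * apply Rmult_le_compat_l.
        -- apply Rmult_le_pos; [lra|apply lip_rate_ge0].
        -- rewrite <- exp_0 at 1. destruct (Rabs_pos (lip_primitive r - lip_primitive tau)) as [Hlt|E0].
           ++ left. apply exp_increasing. lra.
           ++ rewrite <- E0, Rmult_0_r. lra.
  - exists x. split; auto.
Qed.

End Perturbed.

(** * Asymptotically normalised solutions under a dichotomy *)

Lemma limit_at_infinity (X : NormedSpace) (x : R -> X) : complete X ->
  (forall e, 0 < e -> exists M, forall r s, M < r -> r <= s -> ⟦x s ⊖ x r⟧ < e) ->
  exists l, forall e, 0 < e -> exists M, forall r, M < r -> ⟦x r ⊖ l⟧ < e.
Proof.
  intros HX Hc.
  assert (Hc2 : forall e, 0 < e -> exists M, forall r s, M < r -> M < s -> ⟦x s ⊖ x r⟧ < e).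
  { intros e He. destruct (Hc e He) as [M HM]. exists M. intros r s Hr Hs.
    destruct (Rle_dec r s); [auto|]. rewrite norm_subC. apply HM; lra. }
  destruct (HX (fun n => x (INR n))) as [l Hl].
  { intros e He. destruct (Hc2 e He) as [M HM].
    destruct (INR_unbounded M) as [k Hk]. exists k. intros i j Hi Hj.
    apply le_INR in Hi. apply le_INR in Hj. apply HM; lra. }
  exists l. intros e He. destruct (Hc2 (e / 2) ltac:(lra)) as [M HM]. exists M. intros r Hr.
  destruct (Hl (e / 2) ltac:(lra)) as [k Hk]. destruct (INR_unbounded M) as [k' Hk'].
  specialize (Hk (k + k')%nat ltac:(lia)).
  assert (Hi : M < INR (k + k')) by (rewrite plus_INR; pose proof (pos_INR k); lra).
  specialize (HM (INR (k + k')) r Hi Hr).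
  eapply Rle_lt_trans; [apply (norm_triangle X (x (INR (k + k'))))|]. lra.
Qed.

Lemma exp_small c e : 0 < c -> 0 < e -> exists M, forall y, y < M -> exp (c * y) < e.
Proof.
  intros Hc He. exists (ln e / c). intros y Hy. rewrite <- (exp_ln e) by auto.
  apply exp_increasing. apply (Rmult_lt_compat_l c) in Hy; auto.
  replace (c * (ln e / c)) with (ln e) in Hy by (field; lra). exact Hy.
Qed.

Section Dichotomy.
Variable X : NormedSpace.
Hypothesis HX : complete X.
Variables (A : R -> X -> X) (T : R -> R -> X -> X) (N C : R -> R).
Hypothesis HA : forall t, bounded_linear (A t).
Hypothesis HT : evolution_operator A T.
Hypothesis HC : forall t, derivable_pt_lim C t (N t).
Hypothesis HN : forall t, 0 <= N t /\ forall x, ⟦A t x⟧ <= N t * ⟦x⟧.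
(** The dichotomy in logarithmic form: [lh], [lk] stand for [ln h], [ln k], the constants [ca], [cb]
    for [|a|], [b], the weights [mh], [mk] for [mu(|t|)^eps], [nu(|t|)^eps], and [m] for the minimum
    bounding [f]. [Hmh] and [Hmk] record the cancellation of the nonuniform weights. *)
Variables (P : R -> X -> X) (lh dlh lk dlk mh mk m : R -> R) (ca cb K : R).
Hypothesis HP : forall t, bounded_linear (P t) /\ forall x, P t (P t x) = P t x.
Hypothesis HPT : forall t s x, P t (T t s x) = T t s (P s x).
Hypothesis Hca : 0 < ca.
Hypothesis Hcb : 0 < cb.
Hypothesis HK : 0 < K.
Hypothesis Dlh : forall t, derivable_pt_lim lh t (dlh t).
Hypothesis Dlk : forall t, derivable_pt_lim lk t (dlk t).
Hypothesis Hmh : forall t, 0 <= mh t * m t <= dlh t.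
Hypothesis Hmk : forall t, 0 <= mk t * m t <= dlk t.
Hypothesis Hmhp : forall t, 0 <= mh t.
Hypothesis Hmkp : forall t, 0 <= mk t.
Hypothesis Hstab : forall t s, s <= t -> forall x,
  ⟦T t s (P s x)⟧ <= K * exp (ca * (lh s - lh t)) * mh s * ⟦x⟧.
Hypothesis Hunst : forall t s, t <= s -> forall x,
  ⟦T t s (x ⊖ P s x)⟧ <= K * exp (cb * (lk t - lk s)) * mk s * ⟦x⟧.
Hypothesis Hlh : forall M, exists r, forall t, t < r -> lh t < M.
Hypothesis Hlk : forall M, exists r, forall t, r < t -> M < lk t.

Let Q0 (x : X) := x ⊖ P 0 x.

Let evol_lin t s : bounded_linear (T t s) := evol_linear X A T HA HT N C HC HN t s.

Lemma Q0_linear : bounded_linear Q0.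
Proof. apply bounded_linear_sub; [apply bounded_linear_id|apply HP]. Qed.

Lemma bounded_linear_comp (L M : X -> X) : bounded_linear L -> bounded_linear M ->
  bounded_linear (fun x => L (M x)).
Proof.
  intros [LA [LS [c Lc]]] [MA [MS [d Md]]]. repeat split; intros.
  - now rewrite MA, LA.
  - now rewrite MS, LS.
  - exists (Rabs c * d). intros x. eapply Rle_trans; [apply Lc|].
    specialize (Md x). pose proof (Rle_abs c). pose proof (norm_ge0 X (M x)).
    pose proof (Rabs_pos c). rewrite Rmult_assoc.
    apply Rle_trans with (Rabs c * ⟦M x⟧).
    + apply Rmult_le_compat_r; auto.
    + apply Rmult_le_compat_l; auto.
Qed.

Lemma exp_comp_deriv (l dl : R -> R) c k0 e t : derivable_pt_lim l t (dl t) -> c <> 0 ->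
  derivable_pt_lim (fun s => k0 / c * exp (c * (l s - e))) t (k0 * exp (c * (l t - e)) * dl t).
Proof.
  intros D Hc. apply is_derive_Reals in D. apply is_derive_Reals.
  evar_last. apply (is_derive_scal (fun s => exp (c * (l s - e))) t (k0 / c)).
  apply (is_derive_comp exp (fun s => c * (l s - e))). apply is_derive_exp.
  apply (is_derive_scal (fun s => l s - e) t c).
  apply (is_derive_minus l (fun _ => e)); [exact D|apply is_derive_const].
  unfold plus, minus, opp, plus, zero, scal; simpl. unfold mult; simpl. field; auto.
Qed.

Section Forced.
Variables (w g : R -> X).
Hypothesis Dw : forall t, has_deriv w t (T 0 t (g t)).

(** The derivative of [T t 0 (P 0 (w u))] in [u] is [T t u (P u (g u))], and the stable estimate,
    valid for [u <= t], bounds it by an exact derivative. *)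
Lemma stable_increment D r s t : r <= s <= t -> 0 <= D ->
  (forall u, r <= u <= s -> ⟦g u⟧ <= D * m u) ->
  ⟦T t 0 (P 0 (w s ⊖ w r))⟧ <=
    K * D / ca * (exp (ca * (lh s - lh t)) - exp (ca * (lh r - lh t))).
Proof.
  intros Hr HD Hgb. rewrite (linear_sub X (P 0)), (linear_sub X (T t 0)) by (auto; apply HP).
  rewrite Rmult_minus_distr_l.
  apply (mean_value_ineq X (fun u => T t 0 (P 0 (w u))) (fun u => T t 0 (P 0 (T 0 u (g u))))
    (fun u => K * D / ca * exp (ca * (lh u - lh t)))
    (fun u => K * D * exp (ca * (lh u - lh t)) * dlh u)); [lra| | |].
  - intros u _. apply (has_deriv_lin X (fun x => T t 0 (P 0 x))); auto.
    apply bounded_linear_comp; auto. apply HP.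
  - intros u _. apply exp_comp_deriv; auto. lra.
  - intros u Hu. rewrite HPT, (evol_comp X A T HT).
    eapply Rle_trans; [apply Hstab; lra|].
    apply Rle_trans with (K * exp (ca * (lh u - lh t)) * mh u * (D * m u)).
    + apply Rmult_le_compat_l; auto.
      apply Rmult_le_pos; auto. left; apply Rmult_lt_0_compat; auto; apply exp_pos.
    + replace (K * exp (ca * (lh u - lh t)) * mh u * (D * m u)) with
        (K * D * exp (ca * (lh u - lh t)) * (mh u * m u)) by ring.
      apply Rmult_le_compat_l; [|apply Hmh].
      apply Rmult_le_pos; [|left; apply exp_pos]. apply Rmult_le_pos; lra.
Qed.

Lemma unstable_increment D r s t : t <= r <= s -> 0 <= D ->
  (forall u, r <= u <= s -> ⟦g u⟧ <= D * m u) ->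
  ⟦T t 0 (Q0 (w s ⊖ w r))⟧ <=
    K * D / cb * (exp (cb * (lk t - lk r)) - exp (cb * (lk t - lk s))).
Proof.
  intros Hr HD Hgb. rewrite (linear_sub X Q0), (linear_sub X (T t 0)) by (auto; apply Q0_linear).
  (* Written as an increment of an increasing primitive in [u], with rate [- cb]. *)
  replace (K * D / cb * (exp (cb * (lk t - lk r)) - exp (cb * (lk t - lk s)))) with
    (K * D / - cb * exp (- cb * (lk s - lk t)) - K * D / - cb * exp (- cb * (lk r - lk t))).
  2:{ replace (- cb * (lk s - lk t)) with (cb * (lk t - lk s)) by ring.
      replace (- cb * (lk r - lk t)) with (cb * (lk t - lk r)) by ring. field. lra. }
  apply (mean_value_ineq X (fun u => T t 0 (Q0 (w u))) (fun u => T t 0 (Q0 (T 0 u (g u))))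
    (fun u => K * D / - cb * exp (- cb * (lk u - lk t)))
    (fun u => K * D * exp (- cb * (lk u - lk t)) * dlk u)); [lra| | |].
  - intros u _. apply (has_deriv_lin X (fun x => T t 0 (Q0 x))); auto.
    apply bounded_linear_comp; auto. apply Q0_linear.
  - intros u _. apply exp_comp_deriv; auto. lra.
  - intros u Hu. unfold Q0. rewrite HPT, <- (linear_sub X (T 0 u)), (evol_comp X A T HT) by auto.
    eapply Rle_trans; [apply Hunst; lra|].
    replace (- cb * (lk u - lk t)) with (cb * (lk t - lk u)) by ring.
    apply Rle_trans with (K * exp (cb * (lk t - lk u)) * mk u * (D * m u)).
    + apply Rmult_le_compat_l; auto.
      apply Rmult_le_pos; auto. left; apply Rmult_lt_0_compat; auto; apply exp_pos.
    + replace (K * exp (cb * (lk t - lk u)) * mk u * (D * m u)) with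
        (K * D * exp (cb * (lk t - lk u)) * (mk u * m u)) by ring.
      apply Rmult_le_compat_l; [|apply Hmk].
      apply Rmult_le_pos; [|left; apply exp_pos]. apply Rmult_le_pos; lra.
Qed.

End Forced.

(* Encodes w(t) = int_{-oo}^t P(0) w' - int_t^{+oo} Q(0) w' without improper integrals *)
Definition normalised (w : R -> X) : Prop :=
  (forall e, 0 < e -> exists M, forall r, r < M -> ⟦P 0 (w r)⟧ < e) /\
  (forall e, 0 < e -> exists M, forall r, M < r -> ⟦Q0 (w r)⟧ < e).

Lemma normalised_sub v w : normalised v -> normalised w -> normalised (fun t => v t ⊖ w t).
Proof.
  intros [V1 V2] [W1 W2]. split; intros e He.
  - destruct (V1 (e / 2) ltac:(lra)) as [M1 H1]. destruct (W1 (e / 2) ltac:(lra)) as [M2 H2].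
    exists (Rmin M1 M2). intros r Hr. rewrite (linear_sub X (P 0)) by apply HP.
    specialize (H1 r (Rlt_le_trans _ _ _ Hr (Rmin_l _ _))).
    specialize (H2 r (Rlt_le_trans _ _ _ Hr (Rmin_r _ _))).
    eapply Rle_lt_trans; [apply norm_sub|]. lra.
  - destruct (V2 (e / 2) ltac:(lra)) as [M1 H1]. destruct (W2 (e / 2) ltac:(lra)) as [M2 H2].
    exists (Rmax M1 M2). intros r Hr. rewrite (linear_sub X Q0) by apply Q0_linear.
    specialize (H1 r (Rle_lt_trans _ _ _ (Rmax_l _ _) Hr)).
    specialize (H2 r (Rle_lt_trans _ _ _ (Rmax_r _ _) Hr)).
    eapply Rle_lt_trans; [apply norm_sub|]. lra.
Qed.

Lemma linear_small (L : X -> X) : bounded_linear L ->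
  forall e, 0 < e -> exists d, 0 < d /\ forall x, ⟦x⟧ < d -> ⟦L x⟧ < e.
Proof.
  intros [_ [_ [c Lc]]] e He. pose proof (Rabs_pos c).
  exists (e / (Rabs c + 1)). split; [apply Rdiv_lt_0_compat; lra|]. intros x Hx.
  eapply Rle_lt_trans; [apply Lc|]. pose proof (Rle_abs c). pose proof (norm_ge0 X x).
  apply (Rmult_lt_compat_l (Rabs c + 1)) in Hx; [|lra].
  replace ((Rabs c + 1) * (e / (Rabs c + 1))) with e in Hx by (field; lra). nra.
Qed.

(** The stable part of [w t] is collected from the past and the unstable part from the future. The
    bound [D] holds on the window and [B] everywhere; what lies outside the window reaches [t]
    damped by the exponential factors. This serves both the global contraction and the local
    continuity estimates. *)
Lemma normalised_estimate w g D B r0 r1 t : (forall t, has_deriv w t (T 0 t (g t))) ->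
  normalised w -> r0 <= t <= r1 -> 0 <= D -> 0 <= B ->
  (forall u, r0 <= u <= r1 -> ⟦g u⟧ <= D * m u) ->
  (forall u, ⟦g u⟧ <= B * m u) ->
  ⟦T t 0 (w t)⟧ <= K / ca * (D + (B - D) * exp (ca * (lh r0 - lh t)))
                 + K / cb * (D + (B - D) * exp (cb * (lk t - lk r1))).
Proof.
  intros Dw [W1 W2] Ht HD HB HgD HgB.
  apply le_of_le_eps with 2; [lra|]. intros e He.
  destruct (linear_small (T t 0) (evol_lin t 0) e He) as [d [Hd Hsm]].
  destruct (W1 d Hd) as [M1 HM1]. destruct (W2 d Hd) as [M2 HM2].
  (* Times so remote that the two leftover terms [P 0 (w r)] and [Q0 (w s)], carried to time [t],
     cost less than [e] each. *)
  set (r := Rmin r0 M1 - 1). set (s := Rmax r1 M2 + 1).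
  assert (Hr : r < M1 /\ r <= r0).
  { unfold r. generalize (Rmin_l r0 M1) (Rmin_r r0 M1). lra. }
  assert (Hs : M2 < s /\ r1 <= s).
  { unfold s. generalize (Rmax_l r1 M2) (Rmax_r r1 M2). lra. }
  assert (E : w t = (P 0 (w t ⊖ w r0) ⊕ P 0 (w r0 ⊖ w r) ⊕ P 0 (w r))
    ⊕ (Q0 (w s) ⊖ Q0 (w s ⊖ w r1) ⊖ Q0 (w r1 ⊖ w t))).
  { rewrite !(linear_sub X (P 0)), !(linear_sub X Q0) by (apply HP || apply Q0_linear).
    unfold Q0. vec. }
  rewrite E. destruct (evol_lin t 0) as [LA _].
  rewrite !LA, !(linear_sub X (T t 0)) by auto.
  assert (S1 := stable_increment w g Dw D r0 t t ltac:(lra) HD ltac:(intros; apply HgD; lra)).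
  assert (S2 := stable_increment w g Dw B r r0 t ltac:(lra) HB ltac:(intros; apply HgB)).
  assert (U1 := unstable_increment w g Dw D t r1 t ltac:(lra) HD ltac:(intros; apply HgD; lra)).
  assert (U2 := unstable_increment w g Dw B r1 s t ltac:(lra) HB ltac:(intros; apply HgB)).
  assert (S3 := Hsm _ (HM1 r (proj1 Hr))). assert (U3 := Hsm _ (HM2 s (proj1 Hs))).
  replace (lh t - lh t) with 0 in S1 by ring. replace (lk t - lk t) with 0 in U1 by ring.
  rewrite Rmult_0_r, exp_0 in S1, U1.
  assert (S4 : K * B / ca * (exp (ca * (lh r0 - lh t)) - exp (ca * (lh r - lh t)))
    <= K * B / ca * exp (ca * (lh r0 - lh t))).
  { apply Rmult_le_compat_l; [|generalize (exp_pos (ca * (lh r - lh t))); lra].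
    apply Rdiv_le_0_compat; auto. apply Rmult_le_pos; lra. }
  assert (U4 : K * B / cb * (exp (cb * (lk t - lk r1)) - exp (cb * (lk t - lk s)))
    <= K * B / cb * exp (cb * (lk t - lk r1))).
  { apply Rmult_le_compat_l; [|generalize (exp_pos (cb * (lk t - lk s))); lra].
    apply Rdiv_le_0_compat; auto. apply Rmult_le_pos; lra. }
  eapply Rle_trans; [apply ns_normD|].
  eapply Rle_trans; [apply Rplus_le_compat;
    [eapply Rle_trans; [apply ns_normD|apply Rplus_le_compat_r, ns_normD]
    |eapply Rle_trans; [apply norm_sub|apply Rplus_le_compat_r, norm_sub]]|].
  replace (K / ca * (D + (B - D) * exp (ca * (lh r0 - lh t)))) with
    (K * D / ca * (1 - exp (ca * (lh r0 - lh t))) + K * B / ca * exp (ca * (lh r0 - lh t)))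
    by (field; lra).
  replace (K / cb * (D + (B - D) * exp (cb * (lk t - lk r1)))) with
    (K * D / cb * (1 - exp (cb * (lk t - lk r1))) + K * B / cb * exp (cb * (lk t - lk r1)))
    by (field; lra).
  lra.
Qed.

Lemma normalised_estimate_global w g D t : (forall t, has_deriv w t (T 0 t (g t))) ->
  normalised w -> 0 <= D -> (forall u, ⟦g u⟧ <= D * m u) ->
  ⟦T t 0 (w t)⟧ <= K * D * (1 / ca + 1 / cb).
Proof.
  intros Dw Nw HD HgD.
  eapply Rle_trans; [apply (normalised_estimate w g D D t t t); auto; lra|].
  right; field; lra.
Qed.

(** By the increment estimates, any primitive [W] has a Cauchy stable part at -oo and a Cauchy
    unstable part at +oo; subtracting a constant removes both limits. *)
Lemma normalised_exists g B : (forall t, curve_cont_at g t) -> 0 <= B ->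
  (forall t, ⟦g t⟧ <= B * m t) ->
  exists w, (forall t, has_deriv w t (T 0 t (g t))) /\ normalised w.
Proof.
  intros Cg HB HgB.
  destruct (curve_primitive X HX _ (evol_pullback_cont X A T HA HT N C HC HN 0 g Cg)) as [W DW].
  assert (HKa : 0 <= K * B / ca) by (apply Rdiv_le_0_compat; auto; apply Rmult_le_pos; lra).
  assert (HKb : 0 <= K * B / cb) by (apply Rdiv_le_0_compat; auto; apply Rmult_le_pos; lra).
  assert (Hcancel : forall y z, 0 < y -> y * (z / y) = z) by (intros; field; lra).
  destruct (limit_at_infinity X (fun r => P 0 (W (- r))) HX) as [p Hp].
  { intros e He. destruct (exp_small ca (e / (K * B / ca + 1)) Hca) as [M HM].
    { apply Rdiv_lt_0_compat; lra. }
    destruct (Hlh (M + lh 0)) as [r0 Hr0]. exists (Rmax 0 (- r0)). intros r s Hr Hs.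
    pose proof (Rmax_l 0 (- r0)). pose proof (Rmax_r 0 (- r0)).
    rewrite norm_subC, <- (linear_sub X (P 0)) by apply HP.
    (* The estimate is read at time 0, where [T 0 0] is the identity; hence [- r] and [- s] were
       kept negative. *)
    rewrite <- (evol_id X A T HT 0 (P 0 (W (- r) ⊖ W (- s)))).
    eapply Rle_lt_trans; [apply (stable_increment W g DW B); auto; lra|].
    assert (H1 := HM (lh (- r) - lh 0)). specialize (Hr0 (- r) ltac:(lra)).
    specialize (H1 ltac:(lra)).
    pose proof (exp_pos (ca * (lh (- s) - lh 0))). pose proof (exp_pos (ca * (lh (- r) - lh 0))).
    apply (Rmult_lt_compat_l (K * B / ca + 1)) in H1; [|lra].
    rewrite Hcancel in H1 by lra.
    assert (0 <= K * B / ca * exp (ca * (lh (- s) - lh 0))) by (apply Rmult_le_pos; lra).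
    lra. }
  destruct (limit_at_infinity X (fun r => Q0 (W r)) HX) as [q Hq].
  { intros e He. destruct (exp_small cb (e / (K * B / cb + 1)) Hcb) as [M HM].
    { apply Rdiv_lt_0_compat; lra. }
    destruct (Hlk (lk 0 - M)) as [r0 Hr0]. exists (Rmax 0 r0). intros r s Hr Hs.
    pose proof (Rmax_l 0 r0). pose proof (Rmax_r 0 r0).
    rewrite <- (linear_sub X Q0) by apply Q0_linear.
    rewrite <- (evol_id X A T HT 0 (Q0 (W s ⊖ W r))).
    eapply Rle_lt_trans; [apply (unstable_increment W g DW B); auto; lra|].
    assert (H1 := HM (lk 0 - lk r)). specialize (Hr0 r ltac:(lra)).
    specialize (H1 ltac:(lra)).
    pose proof (exp_pos (cb * (lk 0 - lk s))). pose proof (exp_pos (cb * (lk 0 - lk r))).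
    apply (Rmult_lt_compat_l (K * B / cb + 1)) in H1; [|lra].
    rewrite Hcancel in H1 by lra.
    assert (0 <= K * B / cb * exp (cb * (lk 0 - lk s))) by (apply Rmult_le_pos; lra).
    lra. }
  destruct (HP 0) as [HP0 PP].
  assert (PA := proj1 HP0).
  (* Projecting the limits again decouples the two corrections: [P 0] fixes the first and kills the
     second, and [Q0] does the opposite. *)
  exists (fun t => W t ⊖ (P 0 p ⊕ Q0 q)). split; [intros t; now apply has_deriv_subr|].
  split; intros e He.
  - destruct (linear_small (P 0) HP0 e He) as [d [Hd Hsm]].
    destruct (Hp d Hd) as [M HM]. exists (- M). intros r Hr.
    replace (P 0 (W r ⊖ (P 0 p ⊕ Q0 q))) with (P 0 (P 0 (W r) ⊖ p)).
    + apply Hsm. specialize (HM (- r) ltac:(lra)). now rewrite Ropp_involutive in HM.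
    + unfold Q0. rewrite !(linear_sub X (P 0)), PA, !(linear_sub X (P 0)), !PP by auto. vec.
  - destruct (linear_small Q0 Q0_linear e He) as [d [Hd Hsm]].
    destruct (Hq d Hd) as [M HM]. exists M. intros r Hr.
    replace (Q0 (W r ⊖ (P 0 p ⊕ Q0 q))) with (Q0 (Q0 (W r) ⊖ q)).
    + apply Hsm. now apply HM.
    + unfold Q0. rewrite !(linear_sub X (P 0)), PA, !(linear_sub X (P 0)), !PP by auto. vec.
Qed.

(** * The conjugacy *)

(** One Gronwall factor for a whole window, wherever [tau] lies: a monotone [u] stays between its
    end values. *)
Lemma monotone_dist_bound (u du : R -> R) r0 r1 tau t :
  (forall t, derivable_pt_lim u t (du t)) -> (forall t, 0 <= du t) -> r0 <= t <= r1 ->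
  exp (Rabs (u t - u tau)) <= exp (Rabs (u r0 - u tau) + Rabs (u r1 - u tau)).
Proof.
  intros D Hp Ht.
  assert (H1 := nonneg_deriv_incr u du D Hp r0 t ltac:(lra)).
  assert (H2 := nonneg_deriv_incr u du D Hp t r1 ltac:(lra)).
  assert (H : Rabs (u t - u tau) <= Rabs (u r0 - u tau) + Rabs (u r1 - u tau)) by (split_Rabs; lra).
  destruct H as [H| ->]; [left; now apply exp_increasing|lra].
Qed.

Section Conjugacy.
Variables (f : R -> X -> X) (alpha gamma : R).
Hypothesis Hm : forall t, 0 <= m t <= dlh t.
Hypothesis Ha : 0 < alpha.
Hypothesis Hg : 0 < gamma.
Hypothesis Hfc : jointly_continuous f.
Hypothesis Hfb : forall t x, ⟦f t x⟧ <= alpha * m t.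
Hypothesis Hfl : forall t x1 x2, ⟦f t x1 ⊖ f t x2⟧ <= gamma * m t * ⟦x1 ⊖ x2⟧.
Hypothesis HAc : op_continuous A.
Let B := K * alpha * (1 / ca + 1 / cb).
Let q := K * gamma * (1 / ca + 1 / cb).
Hypothesis Hq : q < 1.

Lemma shadow_bound_pos : 0 < 1 / ca + 1 / cb.
Proof. apply Rplus_lt_0_compat; apply Rdiv_lt_0_compat; lra. Qed.

Lemma shadow_ratio_bounds : 0 <= q < 1.
Proof.
  split; auto. pose proof shadow_bound_pos.
  unfold q. apply Rmult_le_pos; [apply Rmult_le_pos|]; lra.
Qed.

Lemma shadow_const_ge0 : 0 <= B.
Proof.
  pose proof shadow_bound_pos. unfold B. apply Rmult_le_pos; [apply Rmult_le_pos|]; lra.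
Qed.

(* Boundedness of [x - ell] alone would not determine [ell]: in the nonuniform setting the
   linear equation can have nonzero bounded solutions. *)
Definition shadows (x ell : R -> X) : Prop :=
  is_solution (perturbed A f) x /\ is_solution A ell /\
  normalised (fun t => T 0 t (x t ⊖ ell t)).

Lemma solution_cont F x : is_solution F x -> forall t : R, @curve_cont_at X x t.
Proof. intros S t. eapply has_deriv_cont, S. Qed.

Lemma perturbation_cont x : (forall t, curve_cont_at x t) ->
  forall t, curve_cont_at (fun t => f t (x t)) t.
Proof. intros Cx t. now apply curve_cont_joint. Qed.

Lemma shadow_deriv x ell : is_solution (perturbed A f) x -> is_solution A ell ->
  forall t, has_deriv (fun t => T 0 t (x t ⊖ ell t)) t (T 0 t (f t (x t))).
Proof.
  intros Sx Sl.
  apply (forced_pullback X HX A T HA HT N C HC HN (fun t => x t ⊖ ell t) (fun t => f t (x t))).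
  - apply perturbation_cont. eapply solution_cont, Sx.
  - intros t. rewrite (linear_sub X (A t)) by auto.
    replace (A t (x t) ⊖ A t (ell t) ⊕ f t (x t)) with ((A t (x t) ⊕ f t (x t)) ⊖ A t (ell t)) by vec.
    apply has_deriv_sub; [apply Sx|apply Sl].
Qed.

Lemma shadow_close x ell t : shadows x ell -> ⟦x t ⊖ ell t⟧ <= B.
Proof.
  intros [Sx [Sl Nw]].
  rewrite <- (evol_inv X A T HT t 0 (x t ⊖ ell t)).
  apply (normalised_estimate_global (fun t => T 0 t (x t ⊖ ell t)) (fun t => f t (x t))); auto.
  - now apply shadow_deriv.
  - lra.
Qed.

Lemma shadow_diff_deriv x1 l1 x2 l2 : shadows x1 l1 -> shadows x2 l2 ->
  exists w, (forall t, has_deriv w t (T 0 t (f t (x1 t) ⊖ f t (x2 t)))) /\ normalised w /\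
  forall t, (x1 t ⊖ l1 t) ⊖ (x2 t ⊖ l2 t) = T t 0 (w t).
Proof.
  intros [S1 [L1 N1]] [S2 [L2 N2]].
  exists (fun t => T 0 t (x1 t ⊖ l1 t) ⊖ T 0 t (x2 t ⊖ l2 t)). split; [|split].
  - intros t. rewrite (linear_sub X (T 0 t)) by auto.
    apply has_deriv_sub; now apply shadow_deriv.
  - now apply normalised_sub.
  - intros t. rewrite <- (linear_sub X (T 0 t)) by auto.
    now rewrite (evol_inv X A T HT).
Qed.

Lemma shadow_diff_global x1 l1 x2 l2 D t : shadows x1 l1 -> shadows x2 l2 -> 0 <= D ->
  (forall u, ⟦x1 u ⊖ x2 u⟧ <= D) -> ⟦(x1 t ⊖ l1 t) ⊖ (x2 t ⊖ l2 t)⟧ <= q * D.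
Proof.
  intros H1 H2 HD Hu. destruct (shadow_diff_deriv x1 l1 x2 l2 H1 H2) as [w [Dw [Nw E]]].
  rewrite E. replace (q * D) with (K * (gamma * D) * (1 / ca + 1 / cb)) by (unfold q; ring).
  apply (normalised_estimate_global w (fun t => f t (x1 t) ⊖ f t (x2 t))); auto.
  - apply Rmult_le_pos; lra.
  - intros u. apply Rle_trans with (1 := Hfl u (x1 u) (x2 u)).
    replace (gamma * D * m u) with (gamma * m u * D) by ring.
    apply Rmult_le_compat_l; auto. apply Rmult_le_pos; [lra|apply Hm].
Qed.

(** Outside the window the forcings are compared only through their size, [2 alpha m]; the window is
    wide enough for each tail to contribute at most [e/2]. It depends on [s1], [s2] and [e] but not
    on the solutions, which permits iteration. *)
Lemma shadow_diff_local s1 s2 e : s1 <= s2 -> 0 < e -> exists r0 r1, r0 <= s1 /\ s2 <= r1 /\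
  forall x1 l1 x2 l2 D, shadows x1 l1 -> shadows x2 l2 -> 0 <= D ->
  (forall u, r0 <= u <= r1 -> ⟦x1 u ⊖ x2 u⟧ <= D) ->
  forall t, s1 <= t <= s2 -> ⟦(x1 t ⊖ l1 t) ⊖ (x2 t ⊖ l2 t)⟧ <= q * D + e.
Proof.
  intros Hs He.
  assert (Ilh := nonneg_deriv_incr lh dlh Dlh (fun t => Rle_trans _ _ _ (proj1 (Hm t)) (proj2 (Hm t)))).
  assert (Ilk := nonneg_deriv_incr lk dlk Dlk (fun t => Rle_trans _ _ _ (proj1 (Hmk t)) (proj2 (Hmk t)))).
  assert (Hcancel : forall y z, 0 < y -> y * (z / y) = z) by (intros; field; lra).
  (* Coefficients of the damped tail terms in [normalised_estimate]. *)
  set (ka := K / ca * (2 * alpha)). set (kb := K / cb * (2 * alpha)).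
  assert (Hka : 0 < ka) by (apply Rmult_lt_0_compat; [apply Rdiv_lt_0_compat|]; lra).
  assert (Hkb : 0 < kb) by (apply Rmult_lt_0_compat; [apply Rdiv_lt_0_compat|]; lra).
  destruct (exp_small ca (e / 2 / ka) Hca) as [M1 HM1]; [apply Rdiv_lt_0_compat; lra|].
  destruct (exp_small cb (e / 2 / kb) Hcb) as [M2 HM2]; [apply Rdiv_lt_0_compat; lra|].
  destruct (Hlh (M1 + lh s1)) as [ra Hra]. destruct (Hlk (lk s2 - M2)) as [rb Hrb].
  set (r0 := Rmin s1 (ra - 1)). set (r1 := Rmax s2 (rb + 1)).
  assert (H0 : r0 <= s1) by apply Rmin_l. assert (H1 : s2 <= r1) by apply Rmax_l.
  assert (H0' : r0 < ra) by (generalize (Rmin_r s1 (ra - 1)); unfold r0; lra).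
  assert (H1' : rb < r1) by (generalize (Rmax_r s2 (rb + 1)); unfold r1; lra).
  exists r0, r1. split; [auto|split; auto].
  intros x1 l1 x2 l2 D Sh1 Sh2 HD Hu t Ht.
  destruct (shadow_diff_deriv x1 l1 x2 l2 Sh1 Sh2) as [w [Dw [Nw E]]]. rewrite E.
  eapply Rle_trans; [apply (normalised_estimate w (fun t => f t (x1 t) ⊖ f t (x2 t))
    (gamma * D) (2 * alpha) r0 r1 t); auto; try lra|].
  - apply Rmult_le_pos; lra.
  - intros u Hur. apply Rle_trans with (1 := Hfl u (x1 u) (x2 u)).
    replace (gamma * D * m u) with (gamma * m u * D) by ring.
    apply Rmult_le_compat_l; auto. apply Rmult_le_pos; [lra|apply Hm].
  - intros u. eapply Rle_trans; [apply norm_sub|].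
    generalize (Hfb u (x1 u)) (Hfb u (x2 u)). lra.
  - specialize (HM1 (lh r0 - lh t)). specialize (HM2 (lk t - lk r1)).
    specialize (Hra r0 H0'). specialize (Hrb r1 H1').
    specialize (HM1 ltac:(generalize (Ilh s1 t (proj1 Ht)); lra)).
    specialize (HM2 ltac:(generalize (Ilk t s2 (proj2 Ht)); lra)).
    apply (Rmult_lt_compat_l ka) in HM1; auto. apply (Rmult_lt_compat_l kb) in HM2; auto.
    rewrite Hcancel in HM1, HM2 by auto.
    pose proof (exp_pos (ca * (lh r0 - lh t))). pose proof (exp_pos (cb * (lk t - lk r1))).
    assert (P1 : 0 <= K / ca * (gamma * D) * exp (ca * (lh r0 - lh t))).
    { apply Rmult_le_pos; [|lra]. apply Rmult_le_pos; [left; apply Rdiv_lt_0_compat; lra|].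
      apply Rmult_le_pos; lra. }
    assert (P2 : 0 <= K / cb * (gamma * D) * exp (cb * (lk t - lk r1))).
    { apply Rmult_le_pos; [|lra]. apply Rmult_le_pos; [left; apply Rdiv_lt_0_compat; lra|].
      apply Rmult_le_pos; lra. }
    replace (q * D) with (K / ca * (gamma * D) + K / cb * (gamma * D)) by (unfold q; field; lra).
    unfold ka in HM1. unfold kb in HM2. lra.
Qed.

(** With [x] given, the forcing [f t (x t)] is known, so [ell] is obtained by subtracting the Green
    integral. *)
Lemma shadow_linear_exists x : is_solution (perturbed A f) x -> exists ell, shadows x ell.
Proof.
  intros Sx.
  destruct (normalised_exists (fun t => f t (x t)) alpha) as [w [Dw Nw]]; auto.
  { apply perturbation_cont. eapply solution_cont, Sx. }
  { lra. }
  exists (fun t => x t ⊖ T t 0 (w t)). split; [auto|split].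
  - intros t. rewrite (linear_sub X (A t)) by auto.
    replace (A t (x t) ⊖ A t (T t 0 (w t))) with
      ((A t (x t) ⊕ f t (x t)) ⊖ (A t (T t 0 (w t)) ⊕ f t (x t))) by vec.
    apply has_deriv_sub; [apply Sx|].
    now apply (forced_pushforward X A T HA HT N C HC HN w (fun t => f t (x t))).
  - replace (fun t => T 0 t (x t ⊖ (x t ⊖ T t 0 (w t)))) with w; auto.
    extensionality t. replace (x t ⊖ (x t ⊖ T t 0 (w t))) with (T t 0 (w t)) by vec.
    now rewrite (evol_inv X A T HT).
Qed.

Lemma shadow_linear_unique x l1 l2 t : shadows x l1 -> shadows x l2 -> l1 t = l2 t.
Proof.
  intros H1 H2. apply norm_sub_eq0. apply Rle_antisym; [|apply norm_ge0].
  assert (H := shadow_diff_global x l2 x l1 0 t H2 H1 (Rle_refl _)).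
  replace (x t ⊖ l2 t ⊖ (x t ⊖ l1 t)) with (l1 t ⊖ l2 t) in H by vec.
  rewrite Rmult_0_r in H. apply H. intros u. rewrite norm_sub_diag; lra.
Qed.

Lemma shadow_perturbed_unique x1 x2 ell t : shadows x1 ell -> shadows x2 ell -> x1 t = x2 t.
Proof.
  intros H1 H2. apply norm_sub_eq0. apply Rle_antisym; [|apply norm_ge0].
  destruct shadow_ratio_bounds as [Hq0 _]. pose proof shadow_const_ge0 as HB.
  (* Both curves lie within [B] of [ell], which gives the finite distance [2 * B] from which the
     contraction starts. *)
  assert (Hn : forall n t, ⟦x1 t ⊖ x2 t⟧ <= q ^ n * (2 * B)).
  { induction n; intros s.
    - generalize (shadow_close x1 ell s H1) (shadow_close x2 ell s H2).
      generalize (norm_triangle X (ell s) (x1 s) (x2 s)). rewrite (norm_subC X (ell s)). simpl. lra.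
    - replace (x1 s ⊖ x2 s) with ((x1 s ⊖ ell s) ⊖ (x2 s ⊖ ell s)) by vec.
      eapply Rle_trans; [apply (shadow_diff_global x1 ell x2 ell (q ^ n * (2 * B))); auto|].
      + apply Rmult_le_pos; [now apply pow_le|lra].
      + simpl. right; ring. }
  apply le_of_le_eps with (2 * B + 1); [lra|]. intros e He.
  destruct (pow_lt_1_zero q ltac:(rewrite Rabs_right; lra) e He) as [n Hqn].
  specialize (Hqn n (Nat.le_refl n)). rewrite Rabs_right in Hqn by (apply Rle_ge, pow_le; lra).
  specialize (Hn n t). nra.
Qed.

Lemma shadow_perturbed_exists ell : is_solution A ell -> exists x, shadows x ell.
Proof.
  intros Sl. pose proof shadow_const_ge0 as HB.
  assert (Cl : forall t, curve_cont_at ell t) by (eapply solution_cont, Sl).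
  set (Rel := fun u v : R -> X => exists w, (forall t, has_deriv w t (T 0 t (f t (u t)))) /\
    normalised w /\ forall t, v t = ell t ⊕ T t 0 (w t)).
  (* With the constant weight the distance is the supremum norm, and the first step from [ell] has
     size at most [B]. *)
  destruct (weighted_fixed_point X HX Rel (fun _ => 1) q B ell) as [x [Cx [w [Dw [Nw E]]]]]; auto.
  - apply shadow_ratio_bounds.
  - intros; lra.
  - intros t. exists 1, 1. split; intros; lra.
  - intros u Cu. destruct (normalised_exists (fun t => f t (u t)) alpha) as [w [Dw Nw]]; auto.
    { now apply perturbation_cont. }
    { lra. }
    exists (fun t => ell t ⊕ T t 0 (w t)). split; [|now exists w].
    intros t. apply curve_cont_add; auto. eapply has_deriv_cont.
    now apply (forced_pushforward X A T HA HT N C HC HN w (fun t => f t (u t))).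
  - intros D u1 u2 v1 v2 HD _ _ [w1 [D1 [N1 E1]]] [w2 [D2 [N2 E2]]] Hu t.
    rewrite E1, E2.
    replace (ell t ⊕ T t 0 (w1 t) ⊖ (ell t ⊕ T t 0 (w2 t))) with (T t 0 (w1 t ⊖ w2 t)).
    2:{ rewrite (linear_sub X (T t 0)) by auto. vec. }
    replace (q * D * 1) with (K * (gamma * D) * (1 / ca + 1 / cb)) by (unfold q; ring).
    apply (normalised_estimate_global (fun t => w1 t ⊖ w2 t) (fun t => f t (u1 t) ⊖ f t (u2 t))).
    + intros r. rewrite (linear_sub X (T 0 r)) by auto. now apply has_deriv_sub.
    + now apply normalised_sub.
    + apply Rmult_le_pos; lra.
    + intros r. apply Rle_trans with (1 := Hfl r (u1 r) (u2 r)). specialize (Hu r).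
      replace (gamma * D * m r) with (gamma * m r * D) by ring.
      apply Rmult_le_compat_l; [|lra]. apply Rmult_le_pos; [lra|apply Hm].
  - intros v [w [Dw [Nw E]]] t. rewrite E, Rmult_1_r.
    replace (ell t ⊕ T t 0 (w t) ⊖ ell t) with (T t 0 (w t)) by vec.
    apply (normalised_estimate_global w (fun t => f t (ell t))); auto. lra.
  - exists x. split; [|split; auto].
    + intros t. unfold perturbed. rewrite (functional_extensionality _ _ E).
      rewrite (proj1 (HA t)).
      replace (A t (ell t) ⊕ A t (T t 0 (w t)) ⊕ f t (ell t ⊕ T t 0 (w t))) with
        (A t (ell t) ⊕ (A t (T t 0 (w t)) ⊕ f t (x t))) by (rewrite E; vec).
      apply has_deriv_add; [apply Sl|].
      now apply (forced_pushforward X A T HA HT N C HC HN w (fun t => f t (x t))).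
    + replace (fun t => T 0 t (x t ⊖ ell t)) with w; auto.
      extensionality t. rewrite E.
      replace (ell t ⊕ T t 0 (w t) ⊖ ell t) with (T t 0 (w t)) by vec.
      now rewrite (evol_inv X A T HT).
Qed.

(** * Continuity of the correspondence in both directions *)

Lemma linear_gronwall l1 l2 s t : is_solution A l1 -> is_solution A l2 ->
  ⟦l1 t ⊖ l2 t⟧ <= exp (Rabs (C t - C s)) * ⟦l1 s ⊖ l2 s⟧.
Proof.
  intros S1 S2.
  rewrite <- (evol_unique X A T HT l1 S1 t s), <- (evol_unique X A T HT l2 S2 t s).
  rewrite <- (linear_sub X (T t s)) by auto. now apply (evol_bound X A T HT N C).
Qed.

Lemma to_linear_continuous tau x0 l0 e : shadows x0 l0 -> 0 < e -> exists d, 0 < d /\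
  forall x ell, shadows x ell -> ⟦x tau ⊖ x0 tau⟧ < d -> ⟦ell tau ⊖ l0 tau⟧ < e.
Proof.
  intros H0 He. destruct shadow_ratio_bounds as [Hq0 _].
  destruct (shadow_diff_local tau tau (e / 3)) as [r0 [r1 [Hr0 [Hr1 Hloc]]]]; [lra|lra|].
  set (G := lip_primitive C lh gamma).
  set (E := exp (Rabs (G r0 - G tau) + Rabs (G r1 - G tau))).
  assert (HE : 0 < E) by apply exp_pos.
  (* The second bound keeps [x] within [e/3] of [x0] on the whole window; the first controls the
     term at [tau] itself. *)
  exists (Rmin (e / 3) (e / 3 / E)). split.
  { apply Rmin_glb_lt; [lra|apply Rdiv_lt_0_compat; lra]. }
  intros x ell Hx Hd.
  assert (Hd1 := Rlt_le_trans _ _ _ Hd (Rmin_l _ _)).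
  assert (Hd2 := Rlt_le_trans _ _ _ Hd (Rmin_r _ _)).
  apply (Rmult_lt_compat_l E) in Hd2; auto.
  replace (E * (e / 3 / E)) with (e / 3) in Hd2 by (field; lra).
  assert (Hz : ⟦(x tau ⊖ ell tau) ⊖ (x0 tau ⊖ l0 tau)⟧ <= q * (e / 3) + e / 3).
  { apply Hloc; auto; [lra| |lra]. intros u Hu.
    eapply Rle_trans; [apply (perturbed_gronwall X A f N C lh dlh m gamma) with (s := tau); auto;
      [apply Hx|apply H0]|].
    apply Rle_trans with (E * ⟦x tau ⊖ x0 tau⟧); [|lra].
    apply Rmult_le_compat_r; [apply norm_ge0|].
    apply (monotone_dist_bound G (lip_rate N dlh gamma)); auto.
    - apply lip_primitive_deriv; auto.
    - apply (lip_rate_ge0 X A N dlh m); auto. }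
  replace (ell tau ⊖ l0 tau) with
    ((x tau ⊖ x0 tau) ⊖ ((x tau ⊖ ell tau) ⊖ (x0 tau ⊖ l0 tau))) by vec.
  eapply Rle_lt_trans; [apply norm_sub|].
  assert (q * (e / 3) <= 1 * (e / 3)) by (apply Rmult_le_compat_r; lra). lra.
Qed.

(* Iterating the local contraction estimate trades a larger time window for a factor [q] *)
Lemma to_perturbed_continuous_aux tau x0 l0 n : shadows x0 l0 ->
  forall s1 s2 e, s1 <= s2 -> 0 < e -> exists d, 0 < d /\
  forall x ell, shadows x ell -> ⟦ell tau ⊖ l0 tau⟧ < d -> forall t, s1 <= t <= s2 ->
  ⟦(x t ⊖ ell t) ⊖ (x0 t ⊖ l0 t)⟧ <= q ^ n * (2 * B) + e.
Proof.
  intros H0. destruct shadow_ratio_bounds as [Hq0 _]. pose proof shadow_const_ge0 as HB.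
  induction n; intros s1 s2 e Hs He.
  - exists 1. split; [lra|]. intros x ell Hx _ t _.
    eapply Rle_trans; [apply norm_sub|].
    generalize (shadow_close x ell t Hx) (shadow_close x0 l0 t H0). simpl. lra.
  - destruct (shadow_diff_local s1 s2 (e / 3)) as [r0 [r1 [Hr0 [Hr1 Hloc]]]]; [lra|lra|].
    destruct (IHn r0 r1 (e / 3)) as [d1 [Hd1 IH]]; [lra|lra|].
    set (E := exp (Rabs (C r0 - C tau) + Rabs (C r1 - C tau))).
    assert (HE : 0 < E) by apply exp_pos.
    exists (Rmin d1 (e / 3 / E)). split.
    { apply Rmin_glb_lt; [lra|apply Rdiv_lt_0_compat; lra]. }
    intros x ell Hx Hd t Ht.
    assert (Hd' := Rlt_le_trans _ _ _ Hd (Rmin_l _ _)).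
    assert (Hd2 := Rlt_le_trans _ _ _ Hd (Rmin_r _ _)).
    apply (Rmult_lt_compat_l E) in Hd2; auto.
    replace (E * (e / 3 / E)) with (e / 3) in Hd2 by (field; lra).
    assert (Hp : 0 <= q ^ n * (2 * B)) by (apply Rmult_le_pos; [now apply pow_le|lra]).
    (* On the larger window [x - x0] costs the induction bound, with its own [e/3], and another
       [e/3] for the linear solutions. *)
    eapply Rle_trans; [apply (Hloc x ell x0 l0 (q ^ n * (2 * B) + 2 * (e / 3))); auto; [lra|]|].
    + intros u Hu.
      replace (x u ⊖ x0 u) with (((x u ⊖ ell u) ⊖ (x0 u ⊖ l0 u)) ⊕ (ell u ⊖ l0 u)) by vec.
      eapply Rle_trans; [apply ns_normD|].
      assert (H1 := IH x ell Hx Hd' u Hu).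
      assert (H2 := linear_gronwall ell l0 tau u (proj1 (proj2 Hx)) (proj1 (proj2 H0))).
      assert (H3 : exp (Rabs (C u - C tau)) * ⟦ell tau ⊖ l0 tau⟧ <= E * ⟦ell tau ⊖ l0 tau⟧).
      { apply Rmult_le_compat_r; [apply norm_ge0|].
        apply (monotone_dist_bound C N); auto. intros r; apply HN. }
      lra.
    + simpl. assert (q * (2 * (e / 3)) <= 1 * (2 * (e / 3))) by (apply Rmult_le_compat_r; lra).
      lra.
Qed.

Lemma to_perturbed_continuous tau x0 l0 e : shadows x0 l0 -> 0 < e -> exists d, 0 < d /\
  forall x ell, shadows x ell -> ⟦ell tau ⊖ l0 tau⟧ < d -> ⟦x tau ⊖ x0 tau⟧ < e.
Proof.
  intros H0 He. destruct shadow_ratio_bounds as [Hq0 _]. pose proof shadow_const_ge0 as HB.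
  assert (He' : 0 < e / 3 / (2 * B + 1)) by (apply Rdiv_lt_0_compat; lra).
  destruct (pow_lt_1_zero q ltac:(rewrite Rabs_right; lra) _ He') as [n Hqn].
  specialize (Hqn n (Nat.le_refl n)). rewrite Rabs_right in Hqn by (apply Rle_ge, pow_le; lra).
  apply (Rmult_lt_compat_r (2 * B + 1)) in Hqn; [|lra].
  replace (e / 3 / (2 * B + 1) * (2 * B + 1)) with (e / 3) in Hqn by (field; lra).
  assert (Hp : 0 <= q ^ n) by now apply pow_le.
  destruct (to_perturbed_continuous_aux tau x0 l0 n H0 tau tau (e / 3)) as [d [Hd H]]; [lra|lra|].
  exists (Rmin d (e / 3)). split; [apply Rmin_glb_lt; lra|]. intros x ell Hx Hl.
  assert (Hl1 := Rlt_le_trans _ _ _ Hl (Rmin_l _ _)).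
  assert (Hl2 := Rlt_le_trans _ _ _ Hl (Rmin_r _ _)).
  specialize (H x ell Hx Hl1 tau ltac:(lra)).
  replace (x tau ⊖ x0 tau) with
    (((x tau ⊖ ell tau) ⊖ (x0 tau ⊖ l0 tau)) ⊕ (ell tau ⊖ l0 tau)) by vec.
  eapply Rle_lt_trans; [apply ns_normD|]. lra.
Qed.

Lemma close_norm_coercive (G : R -> X -> X) b : (forall t x, ⟦G t x ⊖ x⟧ <= b) -> norm_coercive G.
Proof.
  intros H M. exists (M + b). intros t x Hx. specialize (H t x).
  generalize (norm_le_sub X x (G t x)). rewrite norm_subC. lra.
Qed.

Theorem shadowing_conjugacy : exists H : R -> X -> X,
  topological_equivalence A f H /\ (forall t x, ⟦H t x ⊖ x⟧ <= B).
Proof.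
  destruct (functional_choice (fun (p : R * X) eta => exists x ell, shadows x ell /\
    x (fst p) = snd p /\ ell (fst p) = eta)) as [H HH].
  { intros [t xi]. destruct (perturbed_ivp X HX A f N C lh dlh m alpha gamma) with (tau := t) (xi := xi)
      as [x [Sx E]]; auto.
    destruct (shadow_linear_exists x Sx) as [ell Hl]. now exists (ell t), x, ell. }
  destruct (functional_choice (fun (p : R * X) xi => exists x ell, shadows x ell /\
    ell (fst p) = snd p /\ x (fst p) = xi)) as [L HL].
  { intros [t eta].
    destruct (shadow_perturbed_exists (fun s => T s t eta)) as [x Hx].
    { intros s. apply (evol_sol X A T HT). }
    exists (x t), x, (fun s => T s t eta). split; [auto|split; auto]. apply (evol_id X A T HT). }
  (* Equality at a single time determines the other member of the pair, so the values of [H] and [L]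
     do not depend on the pairs chosen. *)
  assert (Huniq : forall x1 l1 x2 l2 t, shadows x1 l1 -> shadows x2 l2 ->
    x1 t = x2 t -> forall s, l1 s = l2 s).
  { intros x1 l1 x2 l2 t H1 H2 E.
    assert (E' := perturbed_unique X A f N C lh dlh m gamma HA HC HN Dlh Hm Hg Hfl
      x1 x2 t (proj1 H1) (proj1 H2) E).
    apply functional_extensionality in E'. subst x2. intros s.
    now apply (shadow_linear_unique x1). }
  assert (Huniq' : forall x1 l1 x2 l2 t, shadows x1 l1 -> shadows x2 l2 ->
    l1 t = l2 t -> x1 t = x2 t).
  { intros x1 l1 x2 l2 t H1 H2 E.
    assert (E' : l1 = l2).
    { extensionality s.
      rewrite <- (evol_unique X A T HT l1 (proj1 (proj2 H1)) s t), E.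
      apply (evol_unique X A T HT l2), H2. }
    subst l2. now apply (shadow_perturbed_unique x1 x2 l1). }
  assert (Hclose : forall t x, ⟦H (t, x) ⊖ x⟧ <= B).
  { intros t xi. destruct (HH (t, xi)) as [x [ell [Hx [E1 E2]]]]; simpl in *.
    rewrite <- E2, norm_subC, <- E1. now apply shadow_close. }
  assert (Lclose : forall t x, ⟦L (t, x) ⊖ x⟧ <= B).
  { intros t eta. destruct (HL (t, eta)) as [x [ell [Hx [E1 E2]]]]; simpl in *.
    rewrite <- E2, <- E1. now apply shadow_close. }
  exists (fun t x => H (t, x)). split; auto. split; [|split].
  - apply (close_norm_coercive _ B); auto.
  - exists (fun t x => L (t, x)). split; [|apply (close_norm_coercive _ B); auto].
    intros t. split; [|split; [|split]].
    + intros xi e He. destruct (HH (t, xi)) as [x [ell [Hx [E1 E2]]]]; simpl in *.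
      destruct (to_linear_continuous t x ell e Hx He) as [d [Hd D]].
      exists d; split; auto. intros y Hy.
      destruct (HH (t, y)) as [x' [ell' [Hx' [E1' E2']]]]; simpl in *.
      rewrite <- E2, <- E2'. apply (D x'); auto. now rewrite E1, E1'.
    + intros eta e He. destruct (HL (t, eta)) as [x [ell [Hx [E1 E2]]]]; simpl in *.
      destruct (to_perturbed_continuous t x ell e Hx He) as [d [Hd D]].
      exists d; split; auto. intros y Hy.
      destruct (HL (t, y)) as [x' [ell' [Hx' [E1' E2']]]]; simpl in *.
      rewrite <- E2, <- E2'. apply (D x' ell'); auto. now rewrite E1, E1'.
    + intros xi. destruct (HH (t, xi)) as [x [ell [Hx [E1 E2]]]]; simpl in *.
      destruct (HL (t, H (t, xi))) as [x' [ell' [Hx' [E1' E2']]]]; simpl in *.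
      rewrite <- E2', <- E1. apply (Huniq' x' ell' x ell); auto. now rewrite E1', E2.
    + intros eta. destruct (HL (t, eta)) as [x [ell [Hx [E1 E2]]]]; simpl in *.
      destruct (HH (t, L (t, eta))) as [x' [ell' [Hx' [E1' E2']]]]; simpl in *.
      rewrite <- E2', <- E1. apply (Huniq x' ell' x ell t); auto. now rewrite E1', E2.
  - intros x Sx. destruct (shadow_linear_exists x Sx) as [ell Hl].
    (* The same [ell] serves at every time, since any pair through [x t] has it as linear member. *)
    replace (fun t => H (t, x t)) with ell; [apply Hl|].
    extensionality t. destruct (HH (t, x t)) as [x' [ell' [Hx' [E1 E2]]]]; simpl in *.
    rewrite <- E2. now apply (Huniq x ell x' ell' t).
Qed.

End Conjugacy.

End Dichotomy.

(** * Passage from growth rates to exponential weights *)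

Lemma ln_comp_deriv (u : R -> R) t l : 0 < u t -> derivable_pt_lim u t l ->
  derivable_pt_lim (fun t => ln (u t)) t (l / u t).
Proof.
  intros Hu D. replace (l / u t) with (/ u t * l) by (unfold Rdiv; ring).
  apply (derivable_pt_lim_comp u ln); auto. now apply derivable_pt_lim_ln.
Qed.

Lemma Rpower_ratio x y c : 0 < x -> 0 < y -> Rpower (x / y) c = exp (c * (ln x - ln y)).
Proof.
  intros Hx Hy. unfold Rpower, Rdiv. rewrite ln_mult, ln_Rinv; auto.
  now apply Rinv_0_lt_compat.
Qed.

Lemma growth_rate_ge1 u t : growth_rate u -> 0 <= t -> 1 <= u t.
Proof.
  intros [Hi [_ [H0 _]]] Ht. rewrite <- H0.
  destruct Ht as [Ht| <-]; [left; now apply Hi|lra].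
Qed.

Lemma Rpower_opp_mul x c : Rpower x c * Rpower x (- c) = 1.
Proof. rewrite <- Rpower_plus, Rplus_opp_r. unfold Rpower. now rewrite Rmult_0_l, exp_0. Qed.

Theorem mainTheorem10 (X : NormedSpace) (HX : complete X)
  (A : R -> X -> X) (T : R -> R -> X -> X)
  (h k mu nu h' k' : R -> R) (a b eps K : R)
  (f : R -> X -> X) (alpha gamma : R) :
  (forall t, bounded_linear (A t)) ->
  op_continuous A ->
  evolution_operator A T ->
  growth_rate h -> growth_rate k -> growth_rate mu -> growth_rate nu ->
  (forall t, derivable_pt_lim h t (h' t)) ->
  (forall t, derivable_pt_lim k t (k' t)) ->
  a < 0 -> 0 < b -> 0 <= eps -> 0 < K ->
  nonuniform_dichotomy T h k mu nu a b eps K ->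
  jointly_continuous f ->
  0 < alpha -> 0 < gamma ->
  (forall t x, ns_norm (f t x) <=
     alpha * Rmin (h' t / h t * Rpower (mu (Rabs t)) (- eps))
                  (k' t / k t * Rpower (nu (Rabs t)) (- eps))) ->
  (forall t x1 x2, ns_norm (ns_sub (f t x1) (f t x2)) <=
     gamma * Rmin (h' t / h t * Rpower (mu (Rabs t)) (- eps))
                  (k' t / k t * Rpower (nu (Rabs t)) (- eps))
           * ns_norm (ns_sub x1 x2)) ->
  K * gamma * (1 / Rabs a + 1 / b) < 1 ->
  exists H : R -> X -> X,
    topological_equivalence A f H /\
    (forall t x, ns_norm (ns_sub (H t x) x) <= K * alpha * (1 / Rabs a + 1 / b)).
Proof.
  intros HA HAc HT Hh Hk Hmu Hnu Dh Dk Ha Hb Heps HK [P [HP [HPT [Hst Hun]]]] Hfc Hal Hga Hfb Hfl Hq.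
  destruct (operator_norm_primitive X A HA HAc) as [N [C [HC HN]]].
  assert (h_pos := proj1 (proj2 Hh)). assert (k_pos := proj1 (proj2 Hk)).
  set (m := fun t => Rmin (h' t / h t * Rpower (mu (Rabs t)) (- eps))
                          (k' t / k t * Rpower (nu (Rabs t)) (- eps))) in *.
  (* Nonnegativity of the minimum is read off from [0 <= |f(t,0)| <= alpha m(t)]. *)
  assert (m_ge0 : forall t, 0 <= m t).
  { intros t. specialize (Hfb t 0v). pose proof (norm_ge0 X (f t 0v)).
    apply Rmult_le_reg_l with alpha; auto. rewrite Rmult_0_r. unfold m. lra. }
  assert (Rpower_pos : forall x c, 0 < Rpower x c) by (intros; apply exp_pos).
  assert (Hweight : forall (u : R -> R) r t, m t <= r * Rpower (u (Rabs t)) (- eps) ->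
    0 <= Rpower (u (Rabs t)) eps * m t <= r).
  { intros u r t H. split; [apply Rmult_le_pos; auto; left; apply Rpower_pos|].
    apply Rle_trans with (Rpower (u (Rabs t)) eps * (r * Rpower (u (Rabs t)) (- eps))).
    - apply Rmult_le_compat_l; auto. left; apply Rpower_pos.
    - right. transitivity (r * (Rpower (u (Rabs t)) eps * Rpower (u (Rabs t)) (- eps))); [ring|].
      rewrite Rpower_opp_mul; ring. }
  assert (Hmh : forall t, 0 <= Rpower (mu (Rabs t)) eps * m t <= h' t / h t).
  { intros t. apply Hweight, Rmin_l. }
  assert (Hmk : forall t, 0 <= Rpower (nu (Rabs t)) eps * m t <= k' t / k t).
  { intros t. apply Hweight, Rmin_r. }
  assert (Hm : forall t, 0 <= m t <= h' t / h t).
  { intros t. split; auto. apply Rle_trans with (2 := proj2 (Hmh t)).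
    rewrite <- (Rmult_1_l (m t)) at 1. apply Rmult_le_compat_r; auto.
    assert (H1 : 1 <= mu (Rabs t)) by (apply growth_rate_ge1; auto; apply Rabs_pos).
    rewrite <- (Rpower_O (mu (Rabs t))) by lra.
    destruct H1 as [H1|H1].
    - apply Rle_Rpower; lra.
    - rewrite <- H1. unfold Rpower. rewrite ln_1, !Rmult_0_r; lra. }
  assert (Ea : Rabs a = - a) by now apply Rabs_left. rewrite Ea in *.
  apply (shadowing_conjugacy X HX A T N C HA HT HC HN P
    (fun t => ln (h t)) (fun t => h' t / h t) (fun t => ln (k t)) (fun t => k' t / k t)
    (fun t => Rpower (mu (Rabs t)) eps) (fun t => Rpower (nu (Rabs t)) eps) m (- a) b K) with (gamma := gamma); auto.
  - lra.
  - intros t. apply ln_comp_deriv; auto.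
  - intros t. apply ln_comp_deriv; auto.
  - intros t; left; apply Rpower_pos.
  - intros t; left; apply Rpower_pos.
  - intros t s Hts x. replace (- a * (ln (h s) - ln (h t))) with (a * (ln (h t) - ln (h s))) by ring.
    rewrite <- Rpower_ratio by auto. now apply Hst.
  - intros t s Hts x. replace (b * (ln (k t) - ln (k s))) with (- b * (ln (k s) - ln (k t))) by ring.
    rewrite <- Rpower_ratio by auto. now apply Hun.
  - intros M. destruct Hh as [_ [_ [_ [_ Hlim]]]]. destruct (Hlim (exp M) (exp_pos M)) as [r Hr].
    exists r. intros t Ht. rewrite <- (ln_exp M). apply ln_increasing; auto.
  - intros M. destruct Hk as [_ [_ [_ [Hlim _]]]]. destruct (Hlim (exp M)) as [r Hr].
    exists r. intros t Ht. rewrite <- (ln_exp M). apply ln_increasing; [apply exp_pos|]. now apply Hr.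
Qed.
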